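(* Let $U\subset\mathbb R^n$ be an open set such that $\overline U^{\mathrm c}$ is locally uniformly quasiconvex and $\partial U=\partial\overline U^{\mathrm c}$. Then there exists a (not necessarily linear) extension operator $$\mathcal E_U\colon\mathcal{DM}^{\mathrm{ext}}(U)\to\mathcal{DM}^{\mathrm{ext}}(\mathbb R^n)$$ such that $\mathcal E_U(\boldsymbol F)$ restricted to $U$ equals $\boldsymbol F$ for all $\boldsymbol F\in\mathcal{DM}^{\mathrm{ext}}(U)$, and $\mathcal E_U$ is bounded in that there is a constant $C$ with $$\|\mathcal E_U(\boldsymbol F)\|_{\mathcal{DM}^{\mathrm{ext}}(\mathbb R^n)}\le C\|\boldsymbol F\|_{\mathcal{DM}^{\mathrm{ext}}(U)}\quad\text{for all }\boldsymbol F\in\mathcal{DM}^{\mathrm{ext}}(U).$$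
   Context: Throughout $n\ge2$; $\overline U^{\mathrm c}=\mathbb R^n\setminus\overline U$ is the complement of the closure of $U$, and $\partial\overline U^{\mathrm c}$ is the boundary of that open set. For $\Omega\subset\mathbb R^n$ open, $\mathcal{DM}^{\mathrm{ext}}(\Omega)$ is the space of finite $\mathbb R^n$-valued Radon measures $\boldsymbol F$ on $\Omega$ whose distributional divergence $\operatorname{div}\boldsymbol F$ is a finite signed Radon measure on $\Omega$, with norm $|\boldsymbol F|(\Omega)+|\operatorname{div}\boldsymbol F|(\Omega)$. An open set $V\subset\mathbb R^n$ is locally uniformly quasiconvex if there exist $\varepsilon,\delta>0$ such that for any distinct $p,q\in\overline V$ with $|p-q|<\delta$ there is a rectifiable curve $\gamma\colon[0,1]\to\mathbb R^n$ with $\gamma(0)=p$, $\gamma(1)=q$, $\gamma(t)\in V$ for all $t\in(0,1)$, whose length satisfies $\ell(\gamma)\le\varepsilon^{-1}|p-q|$. *)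

(* Defs.v *)
From HB Require Import structures.
From mathcomp Require Import all_boot all_order all_algebra.
From mathcomp Require Import all_classical all_reals all_analysis.

Set Implicit Arguments.
Unset Strict Implicit.
Unset Printing Implicit Defensive.

Import Order.TTheory GRing.Theory Num.Theory.
Import numFieldNormedType.Exports.

Local Open Scope classical_set_scope.
Local Open Scope ring_scope.

(* R^n is ['rV[R]_n] with its library (product) topology; the library norm on
   matrices is the sup norm, so the Euclidean norm is defined here. *)
Definition enorm (R : realType) (n : nat) (x : 'rV[R]_n) : R :=
  Num.sqrt (\sum_i x ord0 i ^+ 2).

Definition boundary (T : topologicalType) (A : set T) : set T :=
  closure A `\` interior A.

Definition curve_length (R : realType) (n : nat) (a b : R)
    (gamma : R -> 'rV[R]_n) : \bar R :=
  ereal_sup [set (\sum_(0 <= k < size s)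
      enorm (gamma (nth b (a :: s) k.+1) - gamma (nth b (a :: s) k)))%:E
    | s in itv_partition a b].

Definition locally_uniformly_quasiconvex (R : realType) (n : nat)
    (V : set 'rV[R]_n) : Prop :=
  exists eps delta : R, [/\ 0 < eps, 0 < delta &
    forall p q : 'rV[R]_n, closure V p -> closure V q -> p <> q ->
      enorm (p - q) < delta ->
      exists gamma : R -> 'rV[R]_n,
        [/\ {within `[0, 1], continuous gamma}, gamma 0 = p, gamma 1 = q,
            forall t : R, 0 < t < 1 -> V (gamma t) &
            (curve_length 0 1 gamma < +oo)%E /\
            (curve_length 0 1 gamma <= (eps^-1 * enorm (p - q))%:E)%E]].

Definition borelRn (R : realType) (n : nat) :=
  g_sigma_algebraType (@open 'rV[R]_n).

(* Finite signed Borel measures on R^n; on (open subsets of) R^n they are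
   automatically Radon.  As [charge]s are set functions on all sets, two of them
   are the same measure when they agree on Borel sets, see [same_on]. *)
Definition smeasure (R : realType) (n : nat) := {charge set borelRn R n -> \bar R}.

(* A finite measure on a Borel set [Omega] is encoded as a measure on R^n that
   is concentrated on [Omega], i.e. as its extension by zero. *)
Definition concentrated_on (R : realType) (n : nat) (Omega : set (borelRn R n))
    (mu : smeasure R n) : Prop :=
  forall A, measurable A -> mu A = mu (A `&` Omega).

Section integral_wrt_smeasure.
Variables (R : realType) (n : nat) (mu : smeasure R n).

Definition hahn_pos : set (borelRn R n) := projT1 (cid (Hahn_decomposition mu)).

Definition hahn_neg : set (borelRn R n) :=
  projT1 (cid (projT2 (cid (Hahn_decomposition mu)))).

Lemma hahnP : hahn_decomposition mu hahn_pos hahn_neg.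
Proof. exact: projT2 (cid (projT2 (cid (Hahn_decomposition mu)))). Qed.

Definition sintegral (D : set (borelRn R n)) (f : 'rV[R]_n -> R) : R :=
  \int[jordan_pos hahnP]_(x in D) f x - \int[jordan_neg hahnP]_(x in D) f x.

End integral_wrt_smeasure.

(* R^n-valued finite measures, given by their components *)
Definition vmeasure (R : realType) (n : nat) := 'I_n -> smeasure R n.

Definition vmeasure_val (R : realType) (n : nat) (F : vmeasure R n)
    (A : set (borelRn R n)) : 'rV[R]_n := \row_i fine (F i A).

Definition vvariation (R : realType) (n : nat) (F : vmeasure R n)
    (A : set (borelRn R n)) : \bar R :=
  ereal_sup [set (\sum_(0 <= k <oo) (enorm (vmeasure_val F (B k)))%:E)%E
    | B in [set B : (set (borelRn R n))^nat |
        [/\ forall k, measurable (B k), trivIset setT B & \bigcup_k B k = A]]].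

Definition partial (R : realType) (n : nat) (i : 'I_n) (f : 'rV[R]_n -> R) :
    'rV[R]_n -> R := fun x => 'D_(delta_mx ord0 i) f x.

(* C^infinity: the partial derivatives of every order exist everywhere and are
   continuous *)
Definition smooth (R : realType) (n : nat) (f : 'rV[R]_n -> R) : Prop :=
  forall s : seq 'I_n, let g := foldr (@partial R n) f s in
    continuous g /\ forall x i, derivable g x (delta_mx ord0 i).

Definition test_function (R : realType) (n : nat) (Omega : set 'rV[R]_n)
    (phi : 'rV[R]_n -> R) : Prop :=
  [/\ smooth phi, compact (closure [set x | phi x != 0]) &
      closure [set x | phi x != 0] `<=` Omega].

Definition is_divergence (R : realType) (n : nat) (Omega : set 'rV[R]_n)
    (F : vmeasure R n) (mu : smeasure R n) : Prop :=
  forall phi, test_function Omega phi ->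
    \sum_(i < n) sintegral (F i) Omega (partial i phi) = - sintegral mu Omega phi.

(* [Omega] is meant to be open; the field [dm_div] is then determined by
   [dm_field] on Borel sets. *)
Record DMext (R : realType) (n : nat) (Omega : set 'rV[R]_n) := {
  dm_field :> vmeasure R n ;
  dm_div : smeasure R n ;
  dm_field_on : forall i, concentrated_on Omega (dm_field i) ;
  dm_div_on : concentrated_on Omega dm_div ;
  dm_divP : is_divergence Omega dm_field dm_div }.

Definition DMext_norm (R : realType) (n : nat) (Omega : set 'rV[R]_n)
    (F : DMext Omega) : \bar R :=
  (vvariation F Omega + charge_variation (hahnP (dm_div F)) Omega)%E.

(* [F] and [G] have the same restriction to [Omega] *)
Definition same_on (R : realType) (n : nat) (Omega : set (borelRn R n))
    (F G : vmeasure R n) : Prop :=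
  forall A, measurable A -> A `<=` Omega -> forall i, F i A = G i A.

(* Main.v *)
From Pilot Require Import Defs.
From HB Require Import structures.
From mathcomp Require Import all_boot all_order all_algebra.
From mathcomp Require Import all_classical all_reals all_analysis.
From mathcomp Require Import measurable_realfun.
From mathcomp Require Import ring lra zify.

Set Implicit Arguments.
Unset Strict Implicit.
Unset Printing Implicit Defensive.

Import Order.TTheory GRing.Theory Num.Theory.
Import numFieldNormedType.Exports.
Import Pilot.Defs.

Local Open Scope classical_set_scope.
Local Open Scope ring_scope.

(** Let V be the complement of the closure of U.  For a field F on U and a test
    function phi on R^n, the number
      T(phi) = int_U phi d(div F) + sum_i int_U (d_i phi) dF_i
    ([trace]) is the normal trace of F tested against phi; it vanishes when phi
    is a test function of U.  If T is represented by finite measures nu_0, nu_i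
    that do not charge U, that is T(phi) = int phi dnu_0 + sum_i int (d_i phi)
    dnu_i, then the field F_i - nu_i on R^n restricts to F on U and has divergence
    div F - nu_0 ([extend]).  So everything amounts to representing T by measures
    of mass at most a constant times the norm of F.

    Since T only sees the values of phi near the complement of U, phi may be
    replaced by a Whitney extension of its values on V.  Take a Whitney partition
    of unity chi_k of U, on cubes of radius r_k comparable with the distance to
    the complement, and for each k a node p_k in V at distance O(r_k) of the k-th
    cube.  The functions chi_k (phi - phi(p_k)) are test functions of U, hence
    T(phi) is also obtained from W = sum_k phi(p_k) chi_k ([trace_whitney]).
    Multiplying by sum_k chi_k = 1 and using sum_j d_i chi_j = 0 one finds
      T(phi) = sum_k a_k phi(p_k) + sum_(k,j) c_kj (phi(p_j) - phi(p_k)),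
      a_k = int chi_k d(div F),   c_kj = sum_i int chi_k (d_i chi_j) dF_i
    ([trace_series]), where c_kj = 0 unless the two cubes overlap.  The gradients
    of the partition are O(1/r_k), so sum |a_k| and sum r_k |c_kj| are bounded by
    the norm of F ([weight_bound]).

    The evaluation phi(p_k) is a point mass off U.  For overlapping cubes p_j and
    p_k are at distance O(r_k), and local uniform quasiconvexity joins them by a
    curve in V of length O(r_k).  A fine staircase with axis-parallel steps along
    that curve stays in V, and the fundamental theorem of calculus on each step
    writes phi(p_j) - phi(p_k) as an integral of the partials of phi against
    measures of mass O(r_k) carried by V ([quasiconvex_represented]).  Hence the
    series can be summed to measures nu_0, nu_i as required ([superposition]).

    Three points need care.  Nodes exist because the equality of the boundaries
    makes every point off U a limit of points of V ([exterior_nodes]).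
    Quasiconvexity is only local, so the cubes are given radius at most a small
    fixed s0; a cube of radius s0 may be far from the complement, in which case
    it gets no node and phi(p_k) is replaced by 0, at a cost that is O(r_k) because
    r_k is bounded below.  Finally, the extension has to depend on the restriction
    of the field only: the weights do, since a_k = - sum_i int (d_i chi_k) dF_i, and
    the measures are chosen as a function of the weights. *)

(** * Smooth functions on R^n *)

Section smooth_functions.
Context {R : realType} {n : nat}.
Implicit Types (f g : 'rV[R]_n -> R) (i : 'I_n).

Local Notation e_ i := (delta_mx ord0 i : 'rV[R]_n).

(** Smoothness is defined through sequences of partials; the recursion on the
    order is what lets stability under algebraic operations be proved by
    induction. *)
Fixpoint Ck (k : nat) f : Prop :=
  continuous f /\
  if k is k'.+1 then forall i, (forall x, derivable f x (e_ i)) /\ Ck k' (partial i f)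
  else True.

Lemma smooth_partial f i : smooth f -> smooth (partial i f).
Proof. by move=> sf s; have := sf (rcons s i); rewrite -cats1 foldr_cat. Qed.

Lemma smoothP f : smooth f <-> forall k, Ck k f.
Proof.
split=> [sf k|Cf s].
  elim: k f sf => [|k IH] f sf; first by split=> //; case: (sf [::]).
  split; first by case: (sf [::]).
  move=> i; split=> [x|]; first by case: (sf [::]).
  by apply: IH; exact: smooth_partial.
elim/last_ind: s f Cf => [|s i IH] f Cf.
  split; first by case: (Cf 0).
  by move=> x i; case: (Cf 1) => _ /(_ i)[].
rewrite -cats1 foldr_cat; apply: IH => k.
by case: (Cf k.+1) => _ /(_ i)[].
Qed.

Lemma CkS k f : Ck k.+1 f -> Ck k f.
Proof.
elim: k f => [|k IH] f [cf Cf]; first by split.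
by split=> // i; have [df] := Cf i; split=> //; exact: IH.
Qed.

Lemma Ck_continuous k f : Ck k f -> continuous f.
Proof. by case: k => [|k] []. Qed.

Arguments Ck_continuous {k f} _ x _ _.

Lemma Ck_cst k (c : R) : Ck k (cst c).
Proof.
elim: k c => [|k IH] c; first by split=> //; exact: cst_continuous.
split; first exact: cst_continuous.
move=> i; split=> [x|]; first exact: derivable_cst.
suff -> : partial i (cst c) = cst 0 by exact: IH.
by apply/funext => x; rewrite /partial derive_cst.
Qed.

Lemma CkD k f g : Ck k f -> Ck k g -> Ck k (fun x => f x + g x).
Proof.
elim: k f g => [|k IH] f g [cf Cf] [cg Cg].
  by split=> // x; exact: (continuousD (cf x) (cg x)).
split=> [x|i]; first exact: (continuousD (cf x) (cg x)).
have [[df Cf'] [dg Cg']] := (Cf i, Cg i); split=> [x|]; first exact: derivableD.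
suff -> : partial i (fun x => f x + g x) = fun x => partial i f x + partial i g x.
  exact: IH.
by apply/funext => x; rewrite /partial deriveD.
Qed.

Lemma CkM k f g : Ck k f -> Ck k g -> Ck k (fun x => f x * g x).
Proof.
have cM f' g' : continuous f' -> continuous g' ->
    continuous (fun x : 'rV[R]_n => f' x * g' x : R).
  by move=> cf cg x; have := continuousM (cf x) (cg x).
elim: k f g => [|k IH] f g [cf Cf] [cg Cg]; first by split=> //; exact: cM.
split=> [|i]; first exact: cM.
have [[df Cf'] [dg Cg']] := (Cf i, Cg i).
split=> [x|]; first exact: derivableM.
suff -> : partial i (fun x => f x * g x) =
    fun x => f x * partial i g x + g x * partial i f x.
  by apply: CkD; apply: IH => //; exact: CkS.
by apply/funext => x; rewrite /partial deriveM.
Qed.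

(** The partials of 1/f are polynomials in 1/f and the partials of f, so the
    regularity of 1/f climbs one order at a time. *)
Lemma CkV k f : (forall x, f x != 0) -> Ck k f -> Ck k (fun x => (f x)^-1).
Proof.
move=> f0; elim: k => [|k IH] Cf.
  by split=> // x; have := continuousV (f0 x) (Ck_continuous Cf x).
split=> [x|i]; first by have := continuousV (f0 x) (Ck_continuous Cf x).
have [df Cf'] := Cf.2 i; split=> [x|]; first exact: derivableV.
have CV := IH (CkS Cf).
suff -> : partial i (fun x => (f x)^-1) =
    fun x => cst (-1) x * (((f x)^-1 * (f x)^-1) * partial i f x).
  by apply: CkM; [exact: Ck_cst|apply: CkM => //; exact: CkM].
apply/funext => x; rewrite /partial deriveV//= /GRing.scale/= expr2 invfM.
by rewrite mulN1r mulNr.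
Qed.

Lemma Ck_prod k (I : Type) (r : seq I) (F : I -> 'rV[R]_n -> R) :
  (forall a, Ck k (F a)) -> Ck k (fun x => \prod_(a <- r) F a x).
Proof.
move=> CF; elim: r => [|a r IH].
  by under eq_fun do rewrite big_nil; exact: Ck_cst.
by under eq_fun do rewrite big_cons; exact: CkM.
Qed.

(** Reduces directional derivatives to one variable, where a chain rule is at
    hand. *)
Lemma derive_line f (x v : 'rV[R]_n) :
  'D_v f x = 'D_1 (fun h : R => f (h *: v + x)) 0.
Proof.
rewrite /derive; set g1 := fun h => h^-1 *: _; set g2 := fun h => h^-1 *: _.
suff -> : g1 = g2 by [].
by apply/funext => h; rewrite /g1 /g2/= addr0 scale0r add0r [_%:A]mulr1.
Qed.

Lemma derive_affine f (a : R) (c x v : 'rV[R]_n) : derivable f (a *: (x - c)) v ->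
  derivable (fun y => f (a *: (y - c))) x v /\
  'D_v (fun y => f (a *: (y - c))) x = a * 'D_v f (a *: (x - c)).
Proof.
move=> df.
pose F (h : R) := f (h *: v + a *: (x - c)).
have dF : derivable F 0 1 by move/derivable1P : df.
have FE : (fun h : R => f (a *: (h *: v + x - c))) = F \o (fun h => a * h).
  by apply/funext => h; rewrite /F/= -addrA scalerDr scalerA.
have dG : is_derive (0 : R) 1 (F \o (fun h => a * h)) (a * 'D_1 F 0).
  have da : is_derive (0 : R) (1 : R) (fun h : R => a * h) a.
    have := @is_deriveZ R R R id a 0 1 1 (is_derive_id _ _).
    by rewrite /GRing.scale/= mulr1.
  have dF0 : is_derive (a * 0) 1 F ('D_1 F 0) by rewrite mulr0; exact: derivableP.
  by rewrite mulrC; exact: is_derive1_comp dF0 da.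
have key : 'D_v f (a *: (x - c)) = 'D_1 F 0 by exact: derive_line.
split.
  by apply/derivable1P; rewrite FE; exact: (@ex_derive _ _ _ _ _ _ _ dG).
by rewrite derive_line FE key (@derive_val _ _ _ _ _ _ _ dG).
Qed.

Lemma partial_affine i f (a : R) (c : 'rV[R]_n) :
  (forall x, derivable f x (e_ i)) ->
  partial i (fun y => f (a *: (y - c))) = fun x => a * partial i f (a *: (x - c)).
Proof. by move=> df; apply/funext => x; rewrite /partial (derive_affine (df _)).2. Qed.

Lemma Ck_affine k f (a : R) (c : 'rV[R]_n) :
  Ck k f -> Ck k (fun x => f (a *: (x - c))).
Proof.
have ca : continuous (fun x : 'rV[R]_n => a *: (x - c)).
  move=> x.
  have cB : (fun y : 'rV[R]_n => y - c) @ x --> x - c.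
    exact: cvgB cvg_id (cvg_cst c).
  exact: (cvgZl_tmp cB).
elim: k f => [|k IH] f Cf.
  split=> // x.
  by apply: continuous_comp; [exact: ca|exact: (Ck_continuous Cf)].
split=> [x|i].
  by apply: continuous_comp; [exact: ca|exact: (Ck_continuous Cf)].
have [df Cf'] := Cf.2 i; split=> [x|]; first exact: (derive_affine (df _)).1.
rewrite partial_affine//; apply: (@CkM _ (cst a)); first exact: Ck_cst.
exact: IH.
Qed.

End smooth_functions.

(** * A smooth bump function *)

Section flat.
Context {R : realType}.

(** x^(-k) e^(-1/x) for x > 0.  The case k = 0 is the classical flat function;
    the other values make the family stable under differentiation, so that
    smoothness follows by induction. *)
Definition flat (k : nat) (x : R) : R :=
  if 0 < x then x^-1 ^+ k * expR (- x^-1) else 0.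

Lemma flat_ge0 k x : 0 <= flat k x.
Proof.
rewrite /flat; case: ifP => // x0.
by rewrite mulr_ge0 ?expR_ge0// exprn_ge0// invr_ge0 ltW.
Qed.

Lemma flat_le0 k x : x <= 0 -> flat k x = 0.
Proof. by rewrite /flat leNgt => /negbTE ->. Qed.

Lemma flat_gt0 k x : 0 < x -> 0 < flat k x.
Proof. by rewrite /flat => x0; rewrite x0 mulr_gt0 ?expR_gt0// exprn_gt0// invr_gt0. Qed.

(** From e^y >= y^(k+1)/(k+1)! at y = 1/x.  As h^(-1) flat k h = flat (k+1) h,
    it gives the derivative at the origin. *)
Lemma flat_le k x : 0 <= x -> flat k x <= (k.+1)`!%:R * x.
Proof.
rewrite le_eqVlt => /predU1P[<-|x0]; first by rewrite flat_le0// mulr0.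
rewrite /flat x0 expRN; set y := x^-1.
have y0 : 0 < y by rewrite invr_gt0.
have f0 : 0 < (k.+1)`!%:R :> R by rewrite ltr0n fact_gt0.
rewrite ler_pdivrMr ?expR_gt0//.
have /(le_trans _) : y ^+ k.+1 / (k.+1)`!%:R <= expR y.
  by apply: le_trans (expR_ge1Dxn k (ltW y0)); rewrite lerDr.
move=> H; have -> : y ^+ k = (k.+1)`!%:R * x * (y ^+ k.+1 / (k.+1)`!%:R).
  by rewrite exprS /y; field; rewrite !gt_eqF.
by rewrite ler_pM2l ?mulr_gt0//; exact: H.
Qed.

Lemma flatS k x : 0 < x -> x^-1 * flat k x = flat k.+1 x.
Proof. by move=> x0; rewrite /flat x0 exprS mulrA. Qed.

Lemma is_derive_flat k (x : R) :
  is_derive x 1 (flat k) (- k%:R * flat k.+1 x + flat k.+2 x).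
Proof.
have [x0|x0|->] := ltrgtP x 0.
- have -> : - k%:R * flat k.+1 x + flat k.+2 x = 0 by rewrite !flat_le0 ?ltW// mulr0 addr0.
  apply: (@near_eq_is_derive _ _ _ (cst 0)).
  by near=> y; rewrite flat_le0//; apply/ltW; near: y; exact: lt_nbhsl.
- have dV := @is_deriveV R id x 1 1 (lt0r_neq0 x0) (is_derive_id _ _).
  have dX := @is_deriveX R R (fun y => y^-1) k x 1 _ dV.
  have dN := @is_deriveN R R R (fun y => y^-1) x 1 _ dV.
  have dE := @is_derive1_comp R expR (fun y => - y^-1) x _ _ (is_derive_expR _) dN.
  have dM := @is_deriveM R R _ _ x 1 _ _ dX dE.
  apply: is_derive_eq; first apply: near_eq_is_derive _ dM.
    by near=> y; rewrite /flat ifT ?fctE//; near: y; exact: lt_nbhsr.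
  rewrite /GRing.scale/= /flat x0 !fctE !exprS; case: k {dX dM} => [|k] /=.
    by field; rewrite gt_eqF.
  by rewrite /= exprS; field; rewrite gt_eqF.
- have key : (fun h : R => h^-1 *: ((flat k \o shift 0) (h *: 1) - flat k 0)) @ 0^' --> (0:R).
    rewrite /= [flat k 0]flat_le0//.
    apply/cvgr0Pnorm_le => e e0; near=> h.
    rewrite addr0 subr0 [h%:A]mulr1.
    have [h0|h0] := leP h 0; first by rewrite flat_le0// scaler0 normr0 ltW.
    rewrite /GRing.scale/= flatS// ger0_norm ?flat_ge0//.
    apply: le_trans (flat_le _ (ltW h0)) _.
    rewrite mulrC -ler_pdivlMr ?ltr0n ?fact_gt0//.
    apply/ltW; near: h; apply: nbhs_dnbhs; apply: lt_nbhsl.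
    by rewrite divr_gt0// ltr0n fact_gt0.
  rewrite !flat_le0// mulr0 addr0.
  apply: DeriveDef; first by apply/cvg_ex; exists 0.
  exact: (cvg_lim _ key).
Unshelve. all: by end_near. Qed.

Lemma continuous_flat k : continuous (flat k).
Proof.
move=> x; apply/differentiable_continuous/derivable1_diffP.
exact: (@ex_derive _ _ _ _ _ _ _ (is_derive_flat k x)).
Qed.

Definition step (x : R) : R := flat 0 x / (flat 0 x + flat 0 (1 - x)).

Lemma step_denom_gt0 x : 0 < flat 0 x + flat 0 (1 - x).
Proof.
have [x0|x0] := ltP 0 x; first by rewrite ltr_pwDl ?flat_gt0 ?flat_ge0.
by rewrite ltr_wpDl ?flat_gt0 ?flat_ge0//; lra.
Qed.

Lemma step_ge0 x : 0 <= step x.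
Proof. by rewrite divr_ge0 ?flat_ge0// ltW ?step_denom_gt0. Qed.

Lemma step_le1 x : step x <= 1.
Proof. by rewrite ler_pdivrMr ?step_denom_gt0// mul1r lerDl flat_ge0. Qed.

Lemma step0 x : x <= 0 -> step x = 0.
Proof. by move=> x0; rewrite /step flat_le0// mul0r. Qed.

Lemma step1 x : 1 <= x -> step x = 1.
Proof.
move=> x1; rewrite /step [flat 0 (1 - x)]flat_le0 ?subr_le0// addr0 divff//.
by rewrite gt_eqF// flat_gt0//; lra.
Qed.

End flat.

Section bump.
Context {R : realType} {n : nat}.
Implicit Types (x : 'rV[R]_n) (i : 'I_n).

Lemma continuous_coord i : continuous (fun x => x ord0 i).
Proof. exact: coord_continuous. Qed.

Lemma is_derive_flat_coord k (i j : 'I_n) (a b : R) x :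
  is_derive x (delta_mx ord0 j) (fun y : 'rV[R]_n => flat k (a * y ord0 i + b))
    (a * (i == j)%:R * (- k%:R * flat k.+1 (a * x ord0 i + b) + flat k.+2 (a * x ord0 i + b))).
Proof.
set c := a * x ord0 i + b; set m := a * (i == j)%:R.
have E : (fun h : R => flat k (a * (h *: delta_mx ord0 j + x) ord0 i + b)) =
    flat k \o (fun h => m * h + c).
  by apply/funext => h /=; rewrite !mxE eqxx/= /m /c; congr flat; ring.
have dl : is_derive (0 : R) 1 (fun h : R => m * h + c) m.
  have := @is_deriveD R R R _ _ 0 1 _ _ (@is_deriveZ R R R id m 0 1 1 (is_derive_id _ _))
    (@is_derive_cst R R R c 0 1).
  by rewrite /GRing.scale/= mulr1 addr0.
have dc : is_derive (m * 0 + c) 1 (flat k) (- k%:R * flat k.+1 c + flat k.+2 c).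
  by rewrite mulr0 add0r; exact: is_derive_flat.
have dF := @is_derive1_comp R (flat k) (fun h => m * h + c) 0 _ _ dc dl.
rewrite [m * _]mulrC; split; first by apply/derivable1P; rewrite E; exact: ex_derive.
by rewrite derive_line E; exact: derive_val.
Qed.

Lemma Ck_flat m k i (a b : R) : Ck m (fun x => flat k (a * x ord0 i + b)).
Proof.
have cf k' : continuous (fun x => flat k' (a * x ord0 i + b)).
  move=> x; have cx : (fun y : 'rV[R]_n => y ord0 i) @ x --> x ord0 i by exact: coord_continuous.
  have ca : (fun y : 'rV[R]_n => a * y ord0 i + b) @ x --> a * x ord0 i + b.
    exact: cvgD (cvgM (cvg_cst a) cx) (cvg_cst b).
  exact: (continuous_comp ca (@continuous_flat R k' _)).
elim: m k => [|m IH] k; first by split.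
split=> // j; split=> [x|].
  exact: (@ex_derive _ _ _ _ _ _ _ (is_derive_flat_coord k i j a b x)).
have -> : partial j (fun x => flat k (a * x ord0 i + b)) =
    fun x => cst (a * (i == j)%:R) x * (cst (- k%:R) x * flat k.+1 (a * x ord0 i + b)
      + flat k.+2 (a * x ord0 i + b)).
  by apply/funext => x; exact: (@derive_val _ _ _ _ _ _ _ (is_derive_flat_coord k i j a b x)).
apply: CkM; first exact: Ck_cst.
apply: CkD; last exact: IH.
by apply: CkM; [exact: Ck_cst|exact: IH].
Qed.

(** Equal to 1 on the cube of sup-radius 1 and to 0 off that of sup-radius 2. *)
Definition cube_bump (x : 'rV[R]_n) : R :=
  \prod_(i < n) (step (2 - x ord0 i) * step (2 + x ord0 i)).

Lemma Ck_step m i (a b : R) : Ck m (fun x => step (a * x ord0 i + b)).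
Proof.
apply: CkM; first exact: Ck_flat.
apply: CkV => [x|]; first by rewrite gt_eqF// step_denom_gt0.
apply: CkD; first exact: Ck_flat.
have -> : (fun x => flat 0 (1 - (a * x ord0 i + b))) =
   (fun x => flat 0 ((- a) * x ord0 i + (1 - b))).
  by apply/funext => x; congr flat; ring.
exact: Ck_flat.
Qed.

Lemma smooth_bump : smooth cube_bump.
Proof.
apply/smoothP => k; apply: Ck_prod => i.
have -> : (fun x => step (2 - x ord0 i) * step (2 + x ord0 i)) =
    fun x => step (-1 * x ord0 i + 2) * step (1 * x ord0 i + 2).
  by apply/funext => x; congr (step _ * step _); ring.
by apply: CkM; exact: Ck_step.
Qed.

Lemma bump_ge0 x : 0 <= cube_bump x.
Proof. by apply: prodr_ge0 => i _; rewrite mulr_ge0 ?step_ge0. Qed.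

Lemma bump_le1 x : cube_bump x <= 1.
Proof.
suff /andP[] : 0 <= cube_bump x <= 1 by [].
rewrite /cube_bump; apply: (big_ind (fun r : R => 0 <= r <= 1)) => [|a b /andP[a0 a1] /andP[b0 b1]|i _]; first by rewrite ler01 lexx.
  by rewrite mulr_ge0// mulr_ile1.
by rewrite mulr_ge0 ?step_ge0//= mulr_ile1 ?step_ge0 ?step_le1.
Qed.

Lemma bump1 x : (forall i, `|x ord0 i| <= 1) -> cube_bump x = 1.
Proof.
move=> x1; apply: big1 => i _; have := x1 i; rewrite ler_norml => /andP[? ?].
by rewrite !step1 ?mulr1//; lra.
Qed.

Lemma bump0 x i : 2 <= `|x ord0 i| -> cube_bump x = 0.
Proof.
move=> xi; apply/eqP; rewrite prodf_seq_eq0; apply/hasP; exists i.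
  by rewrite mem_index_enum.
move: xi; rewrite ler_normr => /orP[xi|xi].
  by rewrite step0 ?mul0r//=; lra.
by rewrite [step (2 + _)]step0 ?mulr0//=; lra.
Qed.

Lemma partial_bump0 j x i : 2 < `|x ord0 i| -> partial j cube_bump x = 0.
Proof.
move=> xi; rewrite /partial (@near_eq_derive _ _ _ _ (cst 0)) ?derive_cst//.
near=> y; apply: (@bump0 _ i); apply/ltW; near: y.
exact: cvgr_gt (cvg_norm (@continuous_coord i x)) _ xi.
Unshelve. all: by end_near. Qed.

(** The partials are continuous and vanish off a compact cube. *)
Lemma partial_bump_bounded : exists2 B : R, 0 < B & forall j x, `|partial j cube_bump x| <= B.
Proof.
have H j : exists B : R, forall x, `|partial j cube_bump x| <= B.
  have cg : continuous (partial j cube_bump) by case: (smooth_bump [:: j]).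
  pose K := [set x : 'rV[R]_n | forall i, `[(-2), 2]%classic (x ord0 i)].
  have cK : compact K by apply: (@rV_compact R n (fun=> `[(-2), 2]%classic)) => i; exact: segment_compact.
  have cN : {within K, continuous (fun x => `|partial j cube_bump x|)}.
    apply: continuous_subspaceT => x.
    have cx : partial j cube_bump @ x --> partial j cube_bump x by exact: cg.
    exact: (cvg_norm cx).
  have [K0|K0] := pselect (K !=set0).
    have [c _ cmax] := compact_EVT_max K0 cK cN.
    exists `|partial j cube_bump c| => x.
    have [Kx|/existsNP[i /negP]] := pselect (K x).
      by apply: cmax; rewrite inE.
    rewrite /= in_itv/= -ler_norml -ltNge => /partial_bump0 ->.
    by rewrite normr0.
  exfalso; apply: K0; exists 0 => i /=; rewrite mxE in_itv/=; lra.
have [B HB] := choice H.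
exists (\big[Num.max/1]_j B j).
  by apply: lt_le_trans ltr01 _; exact: bigmax_ge_id.
by move=> j x; apply: le_trans (HB j x) _; exact: le_bigmax.
Qed.

End bump.

(** * Integrals of bounded functions against finite measures *)

Section finite_measure_integral.
Context d (T : measurableType d) (R : realType).
Implicit Types (mu : {finite_measure set T -> \bar R}) (D : set T) (f : T -> R).

Lemma bounded_integrable mu D f (C : R) : measurable D -> measurable_fun D f ->
  (forall x, D x -> `|f x| <= C) -> mu.-integrable D (EFin \o f).
Proof.
move=> mD mf fC; apply: measurable_bounded_integrable => //.
  by rewrite ltey_eq fin_num_measure.
exists C; split; first exact: num_real.
by move=> M CM x /= Dx; apply: le_trans (fC x Dx) (ltW CM).
Qed.

Lemma Rintegral_sum mu D (I : Type) (r : seq I) (f : I -> T -> R) : measurable D ->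
  (forall s, mu.-integrable D (EFin \o f s)) ->
  \int[mu]_(x in D) (\sum_(s <- r) f s x) = \sum_(s <- r) \int[mu]_(x in D) f s x.
Proof.
move=> mD fi; elim: r => [|s r IH].
  under eq_Rintegral do rewrite big_nil.
  by rewrite big_nil Rintegral_cst// mul0r.
under eq_Rintegral do rewrite big_cons.
rewrite RintegralD// ?IH ?big_cons//.
rewrite (_ : EFin \o _ = (fun x => (\sum_(s <- r) (f s x)%:E)%E)); last first.
  by apply/funext => x /=; rewrite sumEFin.
by apply: integrable_sum => // s' _; exact: fi.
Qed.

Lemma Rintegral_bounded_cvg mu D (u : nat -> T -> R) (g : T -> R) (C : R) :
  measurable D -> (forall s, measurable_fun D (u s)) -> measurable_fun D g ->
  (forall s x, D x -> `|u s x| <= C) ->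
  (forall x, D x -> u ^~ x @ \oo --> g x) ->
  (fun s => \int[mu]_(x in D) u s x) @ \oo --> \int[mu]_(x in D) g x.
Proof.
move=> mD mu_ mg uC ug.
have iC : mu.-integrable D (cst C%:E).
  by apply: (@bounded_integrable mu D (cst C) `|C|) => //; exact: measurable_cst.
have [||||ig _ cv] := @dominated_convergence _ T R mu D mD (fun s => EFin \o u s)
  (EFin \o g) (cst C%:E) _ _ _ iC.
- by move=> s; apply/measurable_EFinP.
- exact/measurable_EFinP.
- by apply: aeW => x Dx; apply: cvg_EFin; [exact: nearW|exact: ug].
- by apply: aeW => x s Dx; rewrite /= lee_fin uC.
by apply: fine_cvg; rewrite fineK//; exact: integrable_fin_num.
Qed.

Lemma Rintegral_normr_le mu D f (C : R) : measurable D -> measurable_fun D f ->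
  (forall x, D x -> `|f x| <= C) -> `|\int[mu]_(x in D) f x| <= C * fine (mu D).
Proof.
move=> mD mf fC; have fi := bounded_integrable mu mD mf fC.
apply: le_trans (le_normr_Rintegral mD fi) _.
rewrite -Rintegral_cst//; apply: le_Rintegral => //.
- by apply: (@bounded_integrable _ _ _ C) => // [|x Dx]; [exact: measurableT_comp|rewrite normr_id fC].
- by apply: (@bounded_integrable _ _ (cst C) `|C|) => //; exact: measurable_cst.
Qed.

(** Only the sum under the integral is assumed bounded, uniformly in the number of
    terms: this is how the weights of the trace are summed. *)
Lemma Rintegral_sum_le mu D (I : finType) (f : I -> T -> R) (C : R) : measurable D ->
  (forall s, measurable_fun D (f s)) ->
  (forall x, D x -> \sum_s `|f s x| <= C) ->
  \sum_s `|\int[mu]_(x in D) f s x| <= C * fine (mu D).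
Proof.
move=> mD mf fC.
have gC s x : D x -> `|f s x| <= C.
  by move=> Dx; apply: le_trans (fC x Dx); rewrite (bigD1 s)//= lerDl sumr_ge0.
have gi s : mu.-integrable D (EFin \o (fun x => `|f s x|)).
  apply: (@bounded_integrable _ _ _ C) => // [|x Dx]; first exact: measurableT_comp.
  by rewrite normr_id gC.
apply: (@le_trans _ _ (\sum_s \int[mu]_(x in D) `|f s x|)).
  by apply: ler_sum => s _; apply: le_normr_Rintegral => //; exact: bounded_integrable (gC s).
rewrite -(@Rintegral_sum _ _ _ _ (fun s x => `|f s x|))//.
apply: le_trans (ler_norm _) _.
apply: Rintegral_normr_le => // [|x Dx].
  by apply: measurable_sum => s; exact: measurableT_comp.
by rewrite ger0_norm ?sumr_ge0//; exact: fC.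
Qed.

End finite_measure_integral.

Section borelRn.
Context {R : realType} {n : nat}.
Implicit Types (f : 'rV[R]_n -> R) (D : set (borelRn R n)).

Lemma open_measurableRn (A : set 'rV[R]_n) : open A -> measurable (A : set (borelRn R n)).
Proof. by move=> oA; apply: sub_sigma_algebra. Qed.

Lemma continuous_measurableRn f D : measurable D -> continuous f ->
  measurable_fun D (f : borelRn R n -> R).
Proof.
move=> mD cf; apply: (measurability _ (RGenOInfty.measurableE R)).
move=> _ [_ [a ->] <-]; apply: measurableI => //; apply: open_measurableRn.
by apply: open_comp; [move=> + _; exact: cf|exact: rray_open].
Qed.

End borelRn.

(** * Signed measures *)

Section bounded_measurable.
Context d (T : measurableType d) (R : realType) (D : set T).
Implicit Types f g : T -> R.

Definition bounded_measurable f :=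
  measurable_fun D f /\ exists C : R, forall x, D x -> `|f x| <= C.

Lemma bounded_measurableD f g : bounded_measurable f -> bounded_measurable g ->
  bounded_measurable (fun x => f x + g x).
Proof.
move=> [mf [C fC]] [mg [C' gC]]; split; first exact: measurable_funD.
by exists (C + C') => x Dx; apply: le_trans (ler_normD _ _) _; rewrite lerD ?fC ?gC.
Qed.

Lemma bounded_measurable_cst (c : R) : bounded_measurable (cst c).
Proof. by split; [exact: measurable_cst|exists `|c|]. Qed.

Lemma bounded_measurableM f g : bounded_measurable f -> bounded_measurable g ->
  bounded_measurable (fun x => f x * g x).
Proof.
move=> [mf [C fC]] [mg [C' gC]]; split; first exact: measurable_funM.
by exists (C * C') => x Dx; rewrite normrM ler_pM ?fC ?gC.
Qed.

Lemma bounded_measurable_sum (I : Type) (r : seq I) (F : I -> T -> R) :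
  (forall i, bounded_measurable (F i)) ->
  bounded_measurable (fun x => \sum_(i <- r) F i x).
Proof.
move=> bF; elim: r => [|i r IH].
  by under eq_fun do rewrite big_nil; exact: bounded_measurable_cst.
by under eq_fun do rewrite big_cons; exact: bounded_measurableD.
Qed.

Lemma bounded_measurable_integrable (mu : {finite_measure set T -> \bar R}) f :
  measurable D -> bounded_measurable f -> mu.-integrable D (EFin \o f).
Proof. by move=> mD [mf [C fC]]; exact: bounded_integrable fC. Qed.

End bounded_measurable.

Section sintegral.
Context {R : realType} {n : nat}.
Implicit Types (mu : smeasure R n) (D : set (borelRn R n)) (f g : 'rV[R]_n -> R).

Local Notation mvar mu := (charge_variation (hahnP mu)).

Lemma sintegral_add mu D f g : measurable D ->
  bounded_measurable D f -> bounded_measurable D g ->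
  sintegral mu D (fun x => f x + g x) = sintegral mu D f + sintegral mu D g.
Proof.
move=> mD bf bg.
by rewrite /sintegral !RintegralD//; try exact: bounded_measurable_integrable; ring.
Qed.

Lemma sintegral_scale mu D f (c : R) : measurable D -> bounded_measurable D f ->
  sintegral mu D (fun x => c * f x) = c * sintegral mu D f.
Proof.
move=> mD bf.
by rewrite /sintegral !RintegralZl//; try exact: bounded_measurable_integrable; ring.
Qed.

Lemma sintegral_ext mu D f g : (forall x, D x -> f x = g x) ->
  sintegral mu D f = sintegral mu D g.
Proof.
by move=> fg; rewrite /sintegral; congr (_ - _); apply: eq_Rintegral => x /[!inE] /fg.
Qed.

Lemma sintegral_zero mu D : measurable D -> sintegral mu D (cst 0) = 0.
Proof. by move=> mD; rewrite /sintegral !Rintegral_cst// !mul0r subrr. Qed.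

Lemma sintegral_sum mu D (I : Type) (r : seq I) (F : I -> 'rV[R]_n -> R) : measurable D ->
  (forall i, bounded_measurable D (F i)) ->
  sintegral mu D (fun x => \sum_(i <- r) F i x) = \sum_(i <- r) sintegral mu D (F i).
Proof.
move=> mD bF; elim: r => [|i r IH].
  by rewrite big_nil -[RHS](@sintegral_zero mu D)//; apply: sintegral_ext => x _; rewrite big_nil.
rewrite big_cons -IH -sintegral_add//; last exact: bounded_measurable_sum.
by apply: sintegral_ext => x _; rewrite big_cons.
Qed.

Lemma sintegral_cvg mu D (u : nat -> 'rV[R]_n -> R) (g : 'rV[R]_n -> R) (C : R) :
  measurable D -> (forall s, measurable_fun D (u s : borelRn R n -> R)) ->
  measurable_fun D (g : borelRn R n -> R) ->
  (forall s x, D x -> `|u s x| <= C) ->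
  (forall x, D x -> u ^~ x @ \oo --> g x) ->
  (fun s => sintegral mu D (u s)) @ \oo --> sintegral mu D g.
Proof.
move=> mD mu_ mg uC ug.
have Hp := Rintegral_bounded_cvg (mu := jordan_pos (hahnP mu)) mD mu_ mg uC ug.
have Hn := Rintegral_bounded_cvg (mu := jordan_neg (hahnP mu)) mD mu_ mg uC ug.
have H := cvgB Hp Hn; exact: H.
Qed.

Lemma sintegral_normr_sum mu D (I : finType) (f : I -> 'rV[R]_n -> R) (C : R) : measurable D ->
  (forall s, measurable_fun D (f s : borelRn R n -> R)) ->
  (forall x, D x -> \sum_s `|f s x| <= C) ->
  \sum_s `|sintegral mu D (f s)| <= C * fine (mvar mu D).
Proof.
move=> mD mf fC.
rewrite fineD ?fin_num_measure// mulrDr.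
apply: le_trans (lerD (Rintegral_sum_le (jordan_pos (hahnP mu)) mD mf fC)
  (Rintegral_sum_le (jordan_neg (hahnP mu)) mD mf fC)).
rewrite -big_split/=; apply: ler_sum => s _; exact: ler_normB.
Qed.

(** Any decomposition of mu computes the integral: mu = mu+ - mu- = a - b gives
    the equality of measures mu+ + b = a + mu-. *)
Lemma sintegral_diff mu D f (a b : {finite_measure set (borelRn R n) -> \bar R}) :
  measurable D -> bounded_measurable D f ->
  (forall A, measurable A -> mu A = a A - b A)%E ->
  sintegral mu D f = \int[a]_(x in D) f x - \int[b]_(x in D) f x.
Proof.
move=> mD bf muE.
have [mf _] := bf.
have int m := @bounded_measurable_integrable _ _ _ D m f mD bf.
set p := jordan_pos (hahnP mu); set q := jordan_neg (hahnP mu).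
have key : (\int[p]_(x in D) (f x)%:E + \int[b]_(x in D) (f x)%:E =
            \int[a]_(x in D) (f x)%:E + \int[q]_(x in D) (f x)%:E)%E.
  rewrite -!integral_measure_add//; try exact/measurable_EFinP; try exact: int.
  apply: eq_measure_integral => A mA _.
  transitivity (p A + b A)%E; first exact: measure_addE.
  transitivity (a A + q A)%E; last by symmetry; exact: measure_addE.
  have : (a A - b A = p A - q A)%E.
    by rewrite -muE// (jordan_decomp (hahnP mu) mA) /cadd/= cscaleN1.
  have fa := fin_num_measure a _ mA; have fb := fin_num_measure b _ mA.
  have fp := fin_num_measure p _ mA; have fq := fin_num_measure q _ mA.
  move=> /(congr1 fine); rewrite !fineB// => h.
  rewrite -[LHS]fineK ?fin_numD ?fp ?fb// -[RHS]fineK ?fin_numD ?fa ?fq//.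
  by rewrite !fineD//; congr EFin; lra.
have fi (m : {finite_measure set (borelRn R n) -> \bar R}) : (\int[m]_(x in D) (f x)%:E)%E \is a fin_num.
  exact: (integrable_fin_num mD (int m)).
have := congr1 fine key; rewrite (fineD (fi p) (fi b)) (fineD (fi a) (fi q)).
by rewrite /sintegral /Rintegral -/p -/q; lra.
Qed.

End sintegral.

Section finite_measure_pack.
Context d (T : measurableType d) (R : realType) (m : {measure set T -> \bar R}).
Hypothesis mT : (m setT < +oo)%E.

Let fin_num_m : fin_num_fun m.
Proof.
move=> A mA; rewrite ge0_fin_numE//; apply: le_lt_trans mT.
by apply: le_measure; rewrite ?inE.
Qed.

(** A copy of [m], to which the structure of a finite measure can be attached
    under the hypothesis that [m] is finite. *)
Definition finite_copy & (m setT < +oo)%E : set T -> \bar R := m.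

HB.instance Definition _ := Measure.on (finite_copy mT).
HB.instance Definition _ :=
  @Measure_isFinite.Build _ _ _ (finite_copy mT) fin_num_m.

Lemma finite_measure_of : exists m' : {finite_measure set T -> \bar R}, forall A, m' A = m A.
Proof. by exists (finite_copy mT). Qed.

End finite_measure_pack.

Section finite_measures.
Context d (T : measurableType d) (R : realType).

Lemma Rintegral_concentrated (m : {finite_measure set T -> \bar R}) (D : set T) (f : T -> R) :
  measurable D -> m (~` D) = 0%E -> bounded_measurable setT f ->
  \int[m]_x f x = \int[m]_(x in D) f x.
Proof.
move=> mD m0 bf; rewrite /Rintegral (@negligible_integral _ _ _ m setT (~` D))//.
- by rewrite setTD setCK.
- exact: measurableC.
- exact: bounded_measurable_integrable.
Qed.

Lemma eq_measure_Rintegral (m m' : {measure set T -> \bar R}) (f : T -> R) :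
  (forall A, measurable A -> m A = m' A) -> \int[m]_x f x = \int[m']_x f x.
Proof. by move=> mm'; congr fine; apply: eq_measure_integral => A mA _; rewrite mm'. Qed.

End finite_measures.

Section smeasure_lemmas.
Context {R : realType} {n : nat}.
Implicit Types (mu : smeasure R n) (D : set (borelRn R n)) (A : set (borelRn R n)).
Local Notation fmeasure := {finite_measure set (borelRn R n) -> \bar R}.
Local Notation mvar mu := (charge_variation (hahnP mu)).

Lemma jordan_pos_val mu A : measurable A -> jordan_pos (hahnP mu) A = mu (A `&` hahn_pos mu).
Proof.
by move=> mA; rewrite jordan_posE cjordan_posE /crestr0 mem_set.
Qed.

Lemma jordan_neg_val mu A : measurable A ->
  jordan_neg (hahnP mu) A = (- mu (A `&` hahn_neg mu))%E.
Proof.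
by move=> mA; rewrite jordan_negE cjordan_negE /crestr0 mem_set.
Qed.

Lemma hahn_measurable mu : measurable (hahn_pos mu) /\ measurable (hahn_neg mu).
Proof. by have [[mP _] [mN _] _ _] := hahnP mu. Qed.

Lemma mvar_concentrated mu D : measurable D -> concentrated_on D mu ->
  jordan_pos (hahnP mu) (~` D) = 0%E /\ jordan_neg (hahnP mu) (~` D) = 0%E.
Proof.
move=> mD cD; have [mP mN] := hahn_measurable mu.
have mDC := measurableC mD.
rewrite jordan_pos_val// jordan_neg_val// (cD _ (measurableI _ _ mDC mP)).
rewrite (cD _ (measurableI _ _ mDC mN)).
have E A : ~` D `&` A `&` D = set0 by rewrite setIAC setICl set0I.
by rewrite !E charge0 oppe0.
Qed.

Lemma mvar_setT mu D : measurable D -> concentrated_on D mu -> mvar mu setT = mvar mu D.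
Proof.
move=> mD /(mvar_concentrated mD)[p0 q0].
rewrite -(setUv D) measureU//; last by rewrite setICr.
  rewrite [X in (_ + X)%E](_ : _ = 0%E) ?adde0//.
  have E : (jordan_pos (hahnP mu) (~` D) + jordan_neg (hahnP mu) (~` D) = 0)%E.
    by rewrite p0 q0 adde0.
  exact: E.
exact: measurableC.
Qed.

Lemma sintegral_concentrated mu D (f : 'rV[R]_n -> R) : measurable D -> concentrated_on D mu ->
  bounded_measurable (setT : set (borelRn R n)) f -> sintegral mu setT f = sintegral mu D f.
Proof.
move=> mD /(mvar_concentrated mD)[p0 q0] bf.
by rewrite /sintegral !(@Rintegral_concentrated _ (borelRn R n) R _ D).
Qed.

(** Minimality of the Jordan decomposition, read off on the two Hahn sets. *)
Lemma mvar_le_diff mu (a b : fmeasure) :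
  (forall A, measurable A -> mu A = a A - b A)%E ->
  (mvar mu setT <= a setT + b setT)%E.
Proof.
move=> muE; have [mP mN] := hahn_measurable mu.
rewrite /charge_variation/= jordan_pos_val// jordan_neg_val// !setTI !muE//.
apply: leeD.
  by apply: (@le_trans _ _ (a (hahn_pos mu))); [rewrite leeBlDr ?fin_num_measure// leeDl|apply: le_measure; rewrite ?inE].
rewrite fin_num_oppeB ?fin_num_measure// addeC.
by apply: (@le_trans _ _ (b (hahn_neg mu))); [rewrite leeBlDr ?fin_num_measure// leeDl|apply: le_measure; rewrite ?inE].
Qed.

Lemma smeasure_sub mu (a b : fmeasure) : exists nu : smeasure R n,
  forall A, nu A = (mu A - (a A - b A))%E.
Proof.
by exists (cadd mu (copp (cadd (charge_of_finite_measure a) (copp (charge_of_finite_measure b))))).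
Qed.

(** The decomposition is kept explicit because the total masses of [p] and [q]
    are what bounds the variation of [nu]. *)
Lemma smeasure_sub_diff mu (a b : fmeasure) (nu : smeasure R n) :
  (forall A, measurable A -> nu A = mu A - (a A - b A))%E ->
  exists p q : fmeasure, [/\ forall A, measurable A -> (nu A = p A - q A)%E,
    forall A, measurable A -> p A = (jordan_pos (hahnP mu) A + b A)%E &
    forall A, measurable A -> q A = (jordan_neg (hahnP mu) A + a A)%E].
Proof.
move=> nuE.
have H (u v : fmeasure) : exists w : fmeasure, forall A, (w A = u A + v A)%E.
  have [|w wE] := @finite_measure_of _ _ _ (measure_add u v).
    by rewrite [X in (X < _)%E]measure_addE lte_add_pinfty// ltey_eq fin_num_measure.
  by exists w => A; rewrite wE; exact: measure_addE.
have [p pE] := H (jordan_pos (hahnP mu)) b.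
have [q qE] := H (jordan_neg (hahnP mu)) a.
exists p, q; split=> [A mA|A _|A _]; [|exact: pE|exact: qE].
rewrite nuE// pE qE.
have : (mu A = jordan_pos (hahnP mu) A - jordan_neg (hahnP mu) A)%E.
  by rewrite (jordan_decomp (hahnP mu) mA) /cadd/= cscaleN1.
move=> ->.
have E (x y z w : \bar R) : x \is a fin_num -> y \is a fin_num -> z \is a fin_num ->
    w \is a fin_num -> (x - y - (z - w) = (x + w) - (y + z))%E.
  case: x y z w => [x||] [y||] [z||] [w||] // _ _ _ _.
  by apply/eqP; rewrite -!(EFinB, EFinD) eqe; apply/eqP; ring.
by apply: E; rewrite fin_num_measure.
Qed.

Lemma sintegral_sub mu (a b : fmeasure) (nu : smeasure R n) (f : 'rV[R]_n -> R) :
  (forall A, measurable A -> nu A = mu A - (a A - b A))%E ->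
  bounded_measurable (setT : set (borelRn R n)) f ->
  sintegral nu setT f = sintegral mu setT f - (\int[a]_x f x - \int[b]_x f x).
Proof.
move=> nuE bf; have [p [q [pq pE qE]]] := smeasure_sub_diff nuE.
have add (m u v : fmeasure) : (forall A, measurable A -> m A = u A + v A)%E ->
    \int[m]_x f x = \int[u]_x f x + \int[v]_x f x.
  move=> mE; have int (k : fmeasure) : k.-integrable setT (EFin \o f).
    exact: bounded_measurable_integrable.
  transitivity (fine (\int[measure_add u v]_x (f x)%:E)%E).
    apply: eq_measure_Rintegral => A mA.
    by transitivity (u A + v A)%E; [exact: mE|symmetry; exact: measure_addE].
  have fi (k : fmeasure) : (\int[k]_x (f x)%:E)%E \is a fin_num.
    exact: (integrable_fin_num measurableT (int k)).
  rewrite integral_measure_add//; try exact: int.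
  by rewrite (fineD (fi u) (fi v)).
rewrite (sintegral_diff (D := setT) _ bf pq) ?(add _ _ _ pE) ?(add _ _ _ qE) /sintegral//.
ring.
Qed.

End smeasure_lemmas.

(** * Variation of signed and vector measures *)

Section enorm.
Context {R : realType} {n : nat}.
Implicit Types x : 'rV[R]_n.

Lemma enorm_ge0 x : 0 <= enorm x.
Proof. exact: sqrtr_ge0. Qed.

Lemma coord_le_enorm x i : `|x ord0 i| <= enorm x.
Proof.
rewrite -sqrtr_sqr; apply: ler_wsqrtr.
by rewrite (bigD1 i)//= lerDl sumr_ge0// => j _; exact: sqr_ge0.
Qed.

Lemma enorm_le_sum x : enorm x <= \sum_i `|x ord0 i|.
Proof.
have S0 : 0 <= \sum_i `|x ord0 i| by apply: sumr_ge0.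
rewrite -(ger0_norm S0) -sqrtr_sqr; apply: ler_wsqrtr.
rewrite expr2 mulr_suml; apply: ler_sum => i _.
rewrite -[leLHS]real_normK ?num_real// expr2 ler_wpM2l// (bigD1 i)//= lerDl.
exact: sumr_ge0.
Qed.

End enorm.

Section vvariation.
Context {R : realType} {n : nat}.
Implicit Types (F : vmeasure R n) (U : set (borelRn R n)).
Local Notation fmeasure := {finite_measure set (borelRn R n) -> \bar R}.
Local Notation mvar mu := (charge_variation (hahnP mu)).

(** The Euclidean norm is at most the l^1 norm, for which the sum over a partition
    is a sum of values of measures and does not depend on the partition. *)
Lemma vvariation_le_diff F (p q : 'I_n -> fmeasure) :
  (forall i A, measurable A -> F i A = p i A - q i A)%E ->
  (vvariation F setT <= \sum_i (p i setT + q i setT))%E.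
Proof.
move=> FE; apply: ub_ereal_sup => _ [B [mB tB BT] <-].
apply: (@le_trans _ _ (\sum_(0 <= k <oo) (\sum_i (p i (B k) + q i (B k))))%E).
  apply: lee_nneseries => [k _ _|k _]; first by rewrite lee_fin enorm_ge0.
  apply: (@le_trans _ _ (\sum_i `|fine (F i (B k))|)%:E).
    rewrite lee_fin; apply: le_trans (enorm_le_sum _) _.
    by apply: ler_sum => i _; rewrite /vmeasure_val mxE.
  rewrite -sumEFin; apply: lee_sum => i _.
  rewrite -abse_EFin fineK ?fin_num_measure// FE//.
  by apply: le_trans (lee_abs_sub _ _) _; rewrite !gee0_abs.
rewrite nneseries_sum; last by move=> i k _; rewrite adde_ge0.
apply: lee_sum => i _; rewrite nneseriesD//.
have E (m : fmeasure) : (\sum_(0 <= k <oo) m (B k) = m setT)%E.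
  by rewrite -BT measure_bigcup//; apply: eq_eseriesl => k; rewrite in_setT.
by rewrite !E.
Qed.

Lemma vvariation_ge0 F U : measurable U -> (0 <= vvariation F U)%E.
Proof.
move=> mU; pose B k := if k is 0%N then U else set0.
apply: le_ereal_sup_tmp; exists (\sum_(0 <= k <oo) (enorm (vmeasure_val F (B k)))%:E)%E.
  exists B => //; split; first by case=> [|k]; [exact: mU|exact: measurable0].
    by apply: ltn_trivIset => -[|k2] [|k1]//= _; rewrite ?set0I ?setI0.
  by apply/seteqP; split => [x [[|k]] _ //|x Ux]; exists 0%N.
by apply: nneseries_ge0 => k _ _; rewrite lee_fin enorm_ge0.
Qed.

(** The partition of U into the two Hahn sets of F_i suffices. *)
Lemma mvar_le_vvariation F U i : measurable U -> (mvar (F i) U <= vvariation F U)%E.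
Proof.
move=> mU; have [mP mN] := hahn_measurable (F i).
set P := hahn_pos _ in mP *; set N := hahn_neg _ in mN *.
have [_ _ PNT PN0] := hahnP (F i).
pose B k := if k is k'.+1 then if k' is 0 then U `&` N else set0 else U `&` P.
have mB k : measurable (B k) by case: k => [|[|k]] /=; [exact: measurableI|exact: measurableI|].
have tB : trivIset setT B.
  apply: ltn_trivIset => -[|[|k2]] [|[|k1]]//= _; rewrite ?set0I ?setI0//.
  by rewrite setIACA PN0 setI0.
have UB : \bigcup_k B k = U.
  apply/seteqP; split => [x [[|[|k]]] _ []//|x Ux].
  have : (P `|` N) x by rewrite PNT.
  by move=> [Px|Nx]; [exists 0|exists 1].
apply: (@le_trans _ _ (\sum_(0 <= k <oo) (enorm (vmeasure_val F (B k)))%:E)%E); last first.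
  by apply: ereal_sup_ubound; exists B.
apply: le_trans (@nneseries_lim_ge _ _ _ 0 2 _); last by move=> k _ _; rewrite lee_fin enorm_ge0.
rewrite big_mkord 2!big_ord_recr big_ord0/= add0e.
have fle A : measurable A -> (`|F i A| <= (enorm (vmeasure_val F A))%:E)%E.
  move=> mA; rewrite -(fineK (fin_num_measure (F i) _ mA)) abse_EFin lee_fin.
  by apply: le_trans (coord_le_enorm _ i); rewrite mxE.
apply: leeD; apply: le_trans (fle _ _).
- by rewrite jordan_pos_val// lee_abs.
- exact: mB 0.
- by rewrite jordan_neg_val// -abseN lee_abs.
- exact: mB 1.
Qed.

End vvariation.

(** * Weighted series of measures *)

Section mixture.
Context d (T : measurableType d) (R : realType).
Local Notation fmeasure := {finite_measure set T -> \bar R}.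
Implicit Types (f g : T -> R).

Lemma Rintegral_setT1 (m : fmeasure) : \int[m]_x (cst 1 x : R) = fine (m setT).
Proof. by rewrite Rintegral_cst// mul1r. Qed.

(** For f >= 0 the convergence is that of a series of nonnegative terms; a bounded
    f is the difference of f + C >= 0 and of the constant C. *)
Lemma positive_mixture (al be : nat -> fmeasure) (a b : nat -> R) (M : R) :
  (forall s, 0 <= a s) -> (forall s, 0 <= b s) ->
  (forall S, \sum_(s < S) (a s * fine (al s setT) + b s * fine (be s setT)) <= M) ->
  exists p : fmeasure,
    (forall N, measurable N -> (forall s, al s N = 0%E /\ be s N = 0%E) -> p N = 0%E) /\
    forall f, bounded_measurable setT f ->
      (fun S => \sum_(s < S) (a s * \int[al s]_x f x + b s * \int[be s]_x f x)) @ \oo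
        --> \int[p]_x f x.
Proof.
move=> a0 b0 SM.
pose m s : {measure set T -> \bar R} :=
  measure_add (mscale (NngNum (a0 s)) (al s)) (mscale (NngNum (b0 s)) (be s)).
have mE s A : (m s A = (a s)%:E * al s A + (b s)%:E * be s A)%E by exact: measure_addE.
have M0 : 0 <= M by apply: le_trans (SM 0); rewrite big_ord0.
have [|p pE] := @finite_measure_of _ _ _ (mseries m 0).
  apply: (@le_lt_trans _ _ M%:E); last exact: ltey.
  apply: lime_le; first by apply: is_cvg_nneseries => k _ _; exact: measure_ge0.
  apply: nearW => S; rewrite big_mkord.
  rewrite (eq_bigr (fun s : 'I_S => (a s * fine (al s setT) + b s * fine (be s setT))%:E)).
    by rewrite sumEFin lee_fin SM.
  by move=> s _; rewrite mE EFinD !EFinM !fineK ?fin_num_measure.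
exists p; split.
  move=> N mN N0; rewrite pE [LHS]eseries0// => s _ _.
  by have [aN bN] := N0 s; rewrite mE aN bN !mule0 adde0.
have pos f : bounded_measurable setT f -> (forall x, 0 <= f x) ->
    (fun S => \sum_(s < S) (a s * \int[al s]_x f x + b s * \int[be s]_x f x)) @ \oo
        --> \int[p]_x f x.
  move=> bf f0; have [mf _] := bf; have mf' : measurable_fun setT (EFin \o f) by exact/measurable_EFinP.
  have i0 s : (0 <= \int[m s]_x (f x)%:E)%E by apply: integral_ge0 => x _; rewrite lee_fin.
  have intE s : (\int[m s]_x (f x)%:E)%E = (a s * \int[al s]_x f x + b s * \int[be s]_x f x)%:E.
    rewrite ge0_integral_measure_add//; last by move=> x _; rewrite /= lee_fin.
    rewrite !ge0_integral_mscale//; try by move=> x _; rewrite /= lee_fin.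
    rewrite EFinD !EFinM !fineK//; exact: integrable_fin_num (bounded_measurable_integrable _ _ bf).
  have cv := @is_cvg_nneseries R (fun s => \int[m s]_x (f x)%:E)%E xpredT 0 (fun s _ _ => i0 s).
  rewrite (_ : (fun S => _) = (fun S => fine (\sum_(0 <= s < S) \int[m s]_x (f x)%:E)%E)); last first.
    apply/funext => S; rewrite big_mkord.
    by under [in RHS]eq_bigr do rewrite intE; rewrite sumEFin.
  apply: fine_cvg; rewrite fineK; last first.
    exact: integrable_fin_num (bounded_measurable_integrable _ _ bf).
  have -> : (\int[p]_x (f x)%:E)%E = (\int[mseries m 0]_x (f x)%:E)%E.
    by apply: eq_measure_integral => A _ _; exact: pE.
  by rewrite ge0_integral_measure_series// => x _; rewrite lee_fin.
move=> f bf; have [mf [C fC]] := bf.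
have bC := bounded_measurable_cst (setT : set T) (C : R).
have bg := bounded_measurableD bf bC.
have fE (mu : fmeasure) : \int[mu]_x f x = \int[mu]_x (f x + C) - \int[mu]_x C.
  rewrite RintegralD//; try exact: bounded_measurable_integrable.
  by rewrite addrK.
have C0 : T -> 0 <= C by move=> x; apply: le_trans (fC x I).
have cg := pos _ bg; have cC := pos _ bC.
rewrite fE.
rewrite (_ : (fun S => _) = (fun S =>
   \sum_(s < S) (a s * \int[al s]_x (f x + C) + b s * \int[be s]_x (f x + C)) -
   \sum_(s < S) (a s * \int[al s]_x C + b s * \int[be s]_x C))); last first.
  by apply/funext => S; rewrite -sumrB; apply: eq_bigr => s _; rewrite !fE; ring.
have H := cvgB (cg _) (cC _); apply: H => x; last by exact: C0.
by rewrite -lerBlDr sub0r; have := fC x I; rewrite ler_norml => /andP[].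
Qed.

(** A negative weight exchanges the two measures of its term, so that only
    [`|w s|] enters the mass. *)
Lemma mixture (al be : nat -> fmeasure) (w : nat -> R) (M : R) :
  (forall S, \sum_(s < S) `|w s| * fine (al s setT + be s setT)%E <= M) ->
  exists p q : fmeasure, [/\ fine (p setT + q setT)%E <= M,
    forall N, measurable N -> (forall s, al s N = 0%E /\ be s N = 0%E) ->
      p N = 0%E /\ q N = 0%E &
    forall f, bounded_measurable setT f ->
      (fun S => \sum_(s < S) w s * (\int[al s]_x f x - \int[be s]_x f x)) @ \oo
        --> \int[p]_x f x - \int[q]_x f x].
Proof.
move=> SM.
pose a s := Num.max (w s) 0; pose b s := Num.max (- w s) 0.
have a0 s : 0 <= a s by rewrite le_max lexx orbT.
have b0 s : 0 <= b s by rewrite le_max lexx orbT.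
have abE s : w s = a s - b s /\ `|w s| = a s + b s.
  rewrite /a /b; case/orP: (le_total 0 (w s)) => w0.
    by rewrite (max_l w0) (@max_r _ _ (- w s) 0) ?oppr_le0// subr0 addr0 ger0_norm.
  rewrite (max_r w0) (@max_l _ _ (- w s) 0) ?oppr_ge0//.
  by rewrite sub0r add0r opprK ler0_norm.
have fm (m : fmeasure) : 0 <= fine (m setT) by apply: fine_ge0.
have fD s : fine (al s setT + be s setT)%E = fine (al s setT) + fine (be s setT).
  by rewrite fineD ?fin_num_measure.
have [S|p [p0 pc]] := @positive_mixture al be a b M a0 b0 _.
  apply: le_trans (SM S); apply: ler_sum => s _.
  rewrite fD (abE s).2 mulrDr lerD// ler_wpM2r ?fm ?lerDl ?lerDr//.
have [S|q [q0 qc]] := @positive_mixture al be b a M b0 a0 _.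
  apply: le_trans (SM S); apply: ler_sum => s _.
  rewrite fD (abE s).2 mulrDr lerD// ler_wpM2r ?fm ?lerDl ?lerDr//.
exists p, q; split.
- have b1 := bounded_measurable_cst (setT : set T) (1 : R).
  have H := cvgD (pc _ b1) (qc _ b1).
  rewrite fineD ?fin_num_measure// -!Rintegral_setT1.
  apply: (cvgr_to_le (H _)); apply: nearW => S; rewrite fctE.
  rewrite -big_split/=; apply: le_trans (SM S); apply: ler_sum => s _.
  by rewrite !Rintegral_setT1 fD (abE s).2 le_eqVlt; apply/orP; left; apply/eqP; ring.
- by move=> N mN N0; split; [exact: p0|exact: q0].
move=> f bf; have H := cvgB (pc f bf) (qc f bf).
rewrite (_ : (fun S => _) = (fun S =>
   \sum_(s < S) (a s * \int[al s]_x f x + b s * \int[be s]_x f x) -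
   \sum_(s < S) (b s * \int[al s]_x f x + a s * \int[be s]_x f x))).
  exact: H.
by apply/funext => S; rewrite -sumrB; apply: eq_bigr => s _; rewrite (abE s).1; ring.
Qed.

End mixture.

(** * Length measure on a segment *)

Section axis_segment.
Context {R : realType} {n : nat}.
Local Notation fmeasure := {finite_measure set (borelRn R n) -> \bar R}.
Local Notation e_ i := (delta_mx ord0 i : 'rV[R]_n).

Lemma continuous_line (a v : 'rV[R]_n) : continuous (fun t : R => a + t *: v).
Proof.
move=> t; have ct : (fun t : R => t *: v) @ t --> t *: v by exact: cvgZr_tmp cvg_id.
exact: cvgD (cvg_cst a) ct.
Qed.

Lemma is_derive_partial (phi : 'rV[R]_n -> R) i (a : 'rV[R]_n) (t : R) :
  (forall x, derivable phi x (e_ i)) ->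
  is_derive t 1 (fun s : R => phi (a + s *: e_ i)) (partial i phi (a + t *: e_ i)).
Proof.
move=> dphi.
have E : (fun h : R => h^-1 *: (phi (a + (h *: 1 + t) *: e_ i) - phi (a + t *: e_ i))) =
         (fun h : R => h^-1 *: (phi (h *: e_ i + (a + t *: e_ i)) - phi (a + t *: e_ i))).
  by apply/funext => h; rewrite scalerDl [h%:A]mulr1 addrCA.
by split; [move: (dphi (a + t *: e_ i)); rewrite /derivable/= -E|rewrite /partial /derive/= -E].
Qed.

(** Lebesgue measure of [0, h] transported to the segment; the integral of a
    partial is then given by the fundamental theorem of calculus. *)
Lemma axis_segment_measure (a : 'rV[R]_n) i (h : R) : 0 <= h ->
  exists m : fmeasure, [/\ m setT = h%:E,
    forall N : set (borelRn R n), measurable N ->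
      (forall t, 0 <= t <= h -> ~ N (a + t *: e_ i)) -> m N = 0%E &
    forall phi, smooth phi -> \int[m]_x partial i phi x = phi (a + h *: e_ i) - phi a].
Proof.
move=> h0; pose I := `[0, h]%classic : set (measurableTypeR R).
have mI : measurable I by exact: measurable_itv.
pose m1 : {measure set (measurableTypeR R) -> \bar R} := mrestr lebesgue_measure mI.
pose phi : measurableTypeR R -> borelRn R n := fun t => a + t *: e_ i.
have mphi : measurable_fun setT phi.
  apply: (@measurability _ _ _ (borelRn R n) _ _ open) => //.
  move=> _ [A oA <-]; rewrite setTI; apply: open_measurable.
  by apply: open_comp => // t _; exact: continuous_line.
pose m2_ : {measure set (borelRn R n) -> \bar R} := pushforward m1 phi.
pose m2 := m2_ mphi.
have m1T : m1 setT = h%:E.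
  by rewrite /m1 /= /mrestr setTI lebesgue_measure_itv/= lte_fin; case: ltP => [_|h0']; 
   rewrite ?sube0//; congr EFin; apply/eqP; rewrite eq_le h0 h0'.
have [|m mE] := @finite_measure_of _ _ _ m2; first by rewrite [X in (X < _)%E]m1T ltey.
exists m; split.
- by rewrite mE; exact: m1T.
- move=> N mN Nt; rewrite mE.
  suff -> : m2 N = m1 set0 by rewrite measure0.
  rewrite /m2/= /m2_/= /pushforward /m1/= /mrestr; congr lebesgue_measure.
  rewrite set0I -subset0 => t [/= Npt]; rewrite /I/= in_itv/= => /Nt; exact.
move=> psi spsi.
have [_ dpsi] := spsi [::]; have [cpart _] := spsi [:: i].
pose f := partial i psi; pose F (t : R) := psi (a + t *: e_ i).
pose g (t : R) := f (a + t *: e_ i).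
have dF (t : R) : is_derive t 1 F (g t) by exact: is_derive_partial.
have cg : continuous g.
  by move=> t; apply: continuous_comp; [exact: continuous_line|exact: cpart].
have cF : continuous F.
  by move=> t; apply/differentiable_continuous/derivable1_diffP; exact: (@ex_derive _ _ _ _ _ _ _ (dF t)).
have m1C : m1 (~` I) = 0%E by rewrite /m1/= /mrestr setICl measure0.
have mIC : measurable (~` I) by exact: measurableC.
have mg : measurable_fun setT (g : measurableTypeR R -> R).
  exact: continuous_measurable_fun.
have mEg : measurable_fun setT (EFin \o (g : measurableTypeR R -> R)) by exact/measurable_EFinP.
have bdg : exists C : R, forall t, I t -> `|g t| <= C.
  have cN : {within `[0, h], continuous (fun t => `|g t|)}.
    by apply: continuous_subspaceT => t; exact: (cvg_norm (cg t)).
  have [c _ cmax] := EVT_max h0 cN.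
  by exists `|g c| => t It; exact: cmax.
have ig : m1.-integrable setT (EFin \o (f \o phi)).
  apply/(negligible_integrable mIC measurableT mEg m1C); rewrite setTD setCK.
  have [C gC] := bdg.
  apply: measurable_bounded_integrable => //.
  - apply: (@le_lt_trans _ _ (m1 setT)); last by rewrite m1T ltey.
    by apply: le_measure; rewrite ?inE.
  - exact: measurable_funTS.
  - exists C; split; first exact: num_real.
    by move=> M CM t /= It; apply: le_trans (gC t It) (ltW CM).
have mf : measurable_fun setT (f : borelRn R n -> R) by exact: continuous_measurableRn.
have step1 : \int[m]_x f x = \int[m2]_x f x.
  by apply: eq_measure_Rintegral => A _; exact: mE.
have step2 : \int[m2]_x f x = \int[m1]_x g x.
  congr fine.
  have := @integral_pushforward _ _ _ _ R phi mphi m1 setT (EFin \o f) _ _ measurableT.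
  rewrite preimage_setT; apply => //; exact/measurable_EFinP.
have step3 : \int[m1]_x g x = \int[lebesgue_measure]_(x in I) g x.
  congr fine; rewrite (negligible_integral mIC measurableT ig m1C) setTD setCK.
  apply: eq_measure_integral => A mA AI.
  by rewrite /m1/= /mrestr (setIidl AI).
rewrite step1 step2 step3 /I.
move: h0; rewrite le_eqVlt => /predU1P[<-|hpos].
  by rewrite set_itv1 Rintegral_set1 scale0r addr0 subrr.
have cvF (b : R) : F x @[x --> b] --> F b by exact: cF.
rewrite /Rintegral (@continuous_FTC2 R g F 0 h hpos).
- by rewrite /F scale0r addr0.
- by apply: continuous_subspaceT.
- split; first by move=> t _; exact: (@ex_derive _ _ _ _ _ _ _ (dF t)).
  + by apply: cvg_at_right_filter; exact: cvF.
  + by apply: cvg_at_left_filter; exact: cvF.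
- by move=> t _; rewrite derive1E; exact: (@derive_val _ _ _ _ _ _ _ (dF t)).
Qed.

End axis_segment.

(** * Functionals represented by measures off a set *)

Section test_functions.
Context {R : realType} {n : nat}.
Implicit Types (phi : 'rV[R]_n -> R).

Lemma smooth_continuous phi : smooth phi -> continuous phi.
Proof. by move=> sphi; case: (sphi [::]). Qed.

Lemma smooth_derivable phi i x : smooth phi -> derivable phi x (delta_mx ord0 i).
Proof. by move=> sphi; case: (sphi [::]). Qed.

Lemma partial_support phi i x : ~ closure [set x | phi x != 0] x -> partial i phi x = 0.
Proof.
move=> nx; rewrite /partial (@near_eq_derive _ _ _ _ (cst 0)) ?derive_cst//.
have oC : open (~` closure [set x | phi x != 0]) by apply/closed_openC/closed_closure.
have := open_nbhs_nbhs (conj oC nx).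
apply: filterS => y ny; apply/eqP; apply: contrapT => /negP y0.
by apply: ny; exact: subset_closure.
Qed.

(** Indexing phi and its partials by one finite type treats the divergence (at
    [None]) and the components of the field (at [Some i]) uniformly. *)
Definition jet (o : option 'I_n) phi : 'rV[R]_n -> R :=
  if o is Some i then partial i phi else phi.

Lemma smooth_jet o phi : smooth phi -> smooth (jet o phi).
Proof. by case: o => [i|] sphi; [exact: smooth_partial|exact: sphi]. Qed.

Lemma jet_bounded o phi : test_function setT phi ->
  exists C : R, forall x, `|jet o phi x| <= C.
Proof.
move=> [sphi cK _]; set K := closure _ in cK.
have cj : continuous (jet o phi) by exact/smooth_continuous/smooth_jet.
have j0 x : ~ K x -> jet o phi x = 0.
  case: o {cj} => [i|] /= nKx; first exact: partial_support.
  apply/eqP; apply: contrapT => /negP px.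
  by apply: nKx; exact: subset_closure.
have cN : {within K, continuous (fun x => `|jet o phi x|)}.
  by apply: continuous_subspaceT => x; exact: (cvg_norm (cj x)).
have [K0|K0] := pselect (K !=set0).
  have [c _ cmax] := compact_EVT_max K0 cK cN.
  exists `|jet o phi c| => x; have [Kx|/j0->] := pselect (K x); last by rewrite normr0.
  by apply: cmax; rewrite inE.
exists 0 => x; rewrite j0 ?normr0// => Kx; by apply: K0; exists x.
Qed.

Lemma jet_bounded_measurable o phi : test_function setT phi ->
  bounded_measurable (setT : set (borelRn R n)) (jet o phi).
Proof.
move=> tphi; split; last by have [C HC] := jet_bounded o tphi; exists C => x _; exact: HC.
have [sphi _ _] := tphi.
by apply: continuous_measurableRn => //; exact/smooth_continuous/smooth_jet.
Qed.

End test_functions.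

Lemma cvg_sumr {R : realType} (I : Type) (r : seq I) (u : I -> nat -> R) (l : I -> R) :
  (forall i, u i @ \oo --> l i) ->
  (fun S => \sum_(i <- r) u i S) @ \oo --> \sum_(i <- r) l i.
Proof.
move=> ul; elim: r => [|i r IH].
  by rewrite big_nil; under eq_fun do rewrite big_nil; exact: cvg_cst.
by rewrite big_cons; under eq_fun do rewrite big_cons; exact: cvgD (ul i) IH.
Qed.

Section represented.
Context {R : realType} {n : nat}.
Local Notation fmeasure := {finite_measure set (borelRn R n) -> \bar R}.
Local Notation family := (option 'I_n -> fmeasure * fmeasure).
Local Notation e_ i := (delta_mx ord0 i : 'rV[R]_n).
Implicit Types (nu : family) (U : set (borelRn R n)) (phi : 'rV[R]_n -> R).

(** A family stands for n + 1 signed measures, each a difference of two finite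
    ones. *)
Definition pairing nu phi : R :=
  \sum_o (\int[(nu o).1]_x jet o phi x - \int[(nu o).2]_x jet o phi x).

Definition carried nu U (M : R) := forall o,
  [/\ fine ((nu o).1 setT + (nu o).2 setT)%E <= M, (nu o).1 U = 0%E & (nu o).2 U = 0%E].

(** The functionals of order at most one whose measures do not charge [U]; [M]
    bounds each of the n + 1 masses separately. *)
Definition represented U (M : R) (L : ('rV[R]_n -> R) -> R) := exists nu,
  carried nu U M /\ forall phi, test_function setT phi -> L phi = pairing nu phi.

Lemma carried_ge0 nu U M : carried nu U M -> 0 <= M.
Proof.
move=> /(_ None)[+ _ _]; apply: le_trans; apply: fine_ge0; exact: adde_ge0.
Qed.

(** Each component is a mixture; the jets of a test function are bounded, so all of
    them converge when tested against phi. *)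
Lemma series_family (nu : nat -> family) U (w m : nat -> R) (M : R) : measurable U ->
  (forall s, carried (nu s) U (m s)) ->
  (forall S, \sum_(s < S) `|w s| * m s <= M) ->
  exists nu', carried nu' U M /\ forall phi, test_function setT phi ->
    (fun S => \sum_(s < S) w s * pairing (nu s) phi) @ \oo --> pairing nu' phi.
Proof.
move=> mU cnu wM.
have H o : exists pq : fmeasure * fmeasure, [/\ fine (pq.1 setT + pq.2 setT)%E <= M,
    pq.1 U = 0%E, pq.2 U = 0%E & forall f, bounded_measurable (setT : set (borelRn R n)) f ->
      (fun S => \sum_(s < S) w s * (\int[(nu s o).1]_x f x - \int[(nu s o).2]_x f x)) @ \oo
        --> \int[pq.1]_x f x - \int[pq.2]_x f x].
  have [S|p [q [pqM pq0 pqc]]] := @mixture _ (borelRn R n) R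
    (fun s => (nu s o).1) (fun s => (nu s o).2) w M.
    apply: le_trans (wM S); apply: ler_sum => s _; rewrite ler_wpM2l//.
    by have [] := cnu s o.
  have [|p0 q0] := pq0 U mU; first by move=> s; have [] := cnu s o.
  by exists (p, q).
have [nu' Hnu'] := choice H.
exists nu'; split; first by move=> o; have [] := Hnu' o.
move=> phi tphi.
rewrite /pairing.
rewrite (_ : (fun S => _) = (fun S => \sum_o \sum_(s < S)
   w s * (\int[(nu s o).1]_x jet o phi x - \int[(nu s o).2]_x jet o phi x))); last first.
  apply/funext => S; rewrite exchange_big/=; apply: eq_bigr => s _.
  by rewrite mulr_sumr.
apply: cvg_sumr => o; have [_ _ _ cv] := Hnu' o.
exact: cv _ (jet_bounded_measurable o tphi).
Qed.

Definition fzero : fmeasure := mzero.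

Definition zero_family : family := fun=> (fzero, fzero).

Lemma pairing_zero_family phi : pairing zero_family phi = 0.
Proof.
by rewrite /pairing big1// => o _; rewrite /Rintegral !integral_measure_zero subrr.
Qed.

Lemma carried_zero_family U M : 0 <= M -> carried zero_family U M.
Proof. by move=> M0 o; split=> //; change (fine (0 + 0 : \bar R)%E <= M); rewrite adde0. Qed.

Lemma represented0 U M : 0 <= M -> represented U M (fun=> 0).
Proof.
move=> M0; exists zero_family; split; first exact: carried_zero_family.
by move=> phi _; rewrite pairing_zero_family.
Qed.

Lemma representedW U M M' L : M <= M' -> represented U M L -> represented U M' L.
Proof.
move=> MM' [nu [cnu Lnu]]; exists nu; split=> // o.
by have [h ? ?] := cnu o; split=> //; exact: le_trans MM'.
Qed.

(** A series with two nonzero weights; the boolean chooses between sum and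
    difference. *)
Lemma representedB U M1 M2 L1 L2 (b : bool) : measurable U ->
  represented U M1 L1 -> represented U M2 L2 ->
  represented U (M1 + M2) (fun phi => L1 phi + (-1) ^+ b * L2 phi).
Proof.
move=> mU [nu1 [c1 r1]] [nu2 [c2 r2]].
pose nu s := if s is 0 then nu1 else nu2.
pose w s : R := if s is s'.+1 then (if s' is 0 then (-1) ^+ b else 0) else 1.
pose m s := if s is 0 then M1 else M2.
have M10 := carried_ge0 c1; have M20 := carried_ge0 c2.
have wsum (F : nat -> R) S : (2 <= S)%N ->
    \sum_(s < S) w s * F s = F 0%N + (-1) ^+ b * F 1%N.
  move=> /subnKC <-; rewrite !big_ord_recl/= mul1r big1 ?addr0// => i _.
  by rewrite /w /= mul0r.
have [|S|nu' [c' r']] := @series_family nu U w m (M1 + M2) mU.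
- by case.
- case: S => [|[|S]]; first by rewrite big_ord0 addr_ge0.
    by rewrite big_ord_recl big_ord0/= normr1 mul1r addr0 lerDl.
  rewrite !big_ord_recl/= normr1 mul1r normrX normrN1 expr1n mul1r big1 ?addr0//.
  by move=> i _; rewrite normr0 mul0r.
exists nu'; split=> // phi tphi.
have := r' phi tphi; rewrite r1// r2// => /cvg_lim <-//.
apply/esym/cvg_lim => //; apply: cvg_near_cst; exists 2%N => // S /= S2.
by rewrite (wsum (fun s => pairing (nu s) phi)).
Qed.

Lemma represented_point U (p : 'rV[R]_n) : measurable U -> ~ U p ->
  represented U 1 (fun phi => phi p).
Proof.
move=> mU nUp.
pose nu : family := fun o => (if o is None then (@dirac _ (borelRn R n) p R : fmeasure) else fzero, fzero).
exists nu; split.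
  have dT : (@dirac _ (borelRn R n) p R setT = 1)%E by exact: diracT.
  have dU : (@dirac _ (borelRn R n) p R U = 0)%E by rewrite /dirac indicE memNset.
  move=> o; split; last by [].
    case: o => [i|] /=; first by change (fine (0 + 0 : \bar R)%E <= 1); rewrite adde0.
    by change (fine (@dirac _ (borelRn R n) p R setT + 0 : \bar R)%E <= 1); rewrite dT adde0.
  by case: o => [i|] //=; exact: dU.
move=> phi tphi.
rewrite /pairing (bigD1 None)//= big1 ?addr0; last first.
  by move=> [i|]//= _; rewrite /Rintegral !integral_measure_zero subrr.
have mphi : measurable_fun (setT : set (borelRn R n)) (EFin \o phi).
  by apply/measurable_EFinP; exact: (jet_bounded_measurable None tphi).1.
rewrite /Rintegral integral_measure_zero subr0.
have := @integral_dirac _ (borelRn R n) p R setT measurableT (EFin \o phi) mphi.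
by rewrite diracE in_setT mul1e /= => ->.
Qed.

(** The length measure of the segment, with the opposite sign when the segment is
    traversed backwards. *)
Lemma represented_axis U (a : 'rV[R]_n) i (c : R) : measurable U ->
  (forall t, `|t| <= `|c| -> 0 <= t * c -> ~ U (a + t *: e_ i)) ->
  represented U `|c| (fun phi => phi (a + c *: e_ i) - phi a).
Proof.
move=> mU nU.
wlog c0 : a c nU / 0 <= c.
  move=> H; have [c0|c0] := ltP c 0; last exact: H.
  have [||nu [cnu rnu]] := H (a + c *: e_ i) (- c).
  - move=> t; rewrite normrN (ltr0_norm c0) => tc tc0; rewrite -addrA -scalerDl.
    have t0 : 0 <= t by nra.
    rewrite ger0_norm// in tc.
    apply: nU; last by nra.
    by rewrite (ltr0_norm c0) ler0_norm; lra.
  - by rewrite oppr_ge0 ltW.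
  rewrite normrN in cnu.
  have := representedB true mU (represented0 U (lexx 0)) (ex_intro _ nu (conj cnu rnu)).
  rewrite add0r => -[nu' [cnu' rnu']]; exists nu'; split=> // phi tphi.
  have E : a + c *: e_ i + (- c) *: e_ i = a by rewrite -addrA -scalerDl subrr scale0r addr0.
  by rewrite -rnu'// E /= expr1 mulN1r sub0r opprB.
have [m [mT m0 mI]] := axis_segment_measure a i c0.
have {}m0 : m U = 0%E.
  apply: m0 => // t /andP[t0 tc]; apply: nU; last by rewrite mulr_ge0.
  by rewrite !ger0_norm.
pose nu : family := fun o => (if o == Some i then m else fzero, fzero).
exists nu; split.
  move=> o; rewrite /nu/=; case: eqP => _; split=> //=.
    by change (fine (m setT + 0 : \bar R)%E <= `|c|); rewrite mT adde0 ger0_norm.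
  by change (fine (0 + 0 : \bar R)%E <= `|c|); rewrite adde0 normr_ge0.
move=> phi [sphi _ _].
rewrite /pairing (bigD1 (Some i))//= eqxx big1 ?addr0; last first.
  by move=> o oi; rewrite /nu (negbTE oi) /Rintegral !integral_measure_zero subrr.
have z : \int[fzero]_x partial i phi x = 0 by rewrite /Rintegral integral_measure_zero.
by rewrite mI// z subr0.
Qed.

End represented.

(** * Staircases along curves *)

Section staircase.
Context {R : realType} {n : nat}.
Local Notation e_ i := (delta_mx ord0 i : 'rV[R]_n).
Implicit Types (U : set (borelRn R n)) (phi : 'rV[R]_n -> R).

Lemma eq_represented U M L L' : (forall phi, L phi = L' phi) ->
  represented (n := n) U M L -> represented U M L'.
Proof. by move=> LL' [nu [cnu rnu]]; exists nu; split=> // phi; rewrite -LL'; exact: rnu. Qed.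

Lemma represented_trans U M1 M2 (x y z : 'rV[R]_n) : measurable U ->
  represented U M1 (fun phi => phi y - phi x) ->
  represented U M2 (fun phi => phi z - phi y) ->
  represented U (M1 + M2) (fun phi => phi z - phi x).
Proof.
move=> mU r1 r2; apply: eq_represented (representedB false mU r1 r2) => phi /=.
by rewrite expr0 mul1r addrC subrKA.
Qed.

Lemma represented_chain U (x : nat -> 'rV[R]_n) (M : nat -> R) m : measurable U ->
  (forall k, (k < m)%N -> represented U (M k) (fun phi => phi (x k.+1) - phi (x k))) ->
  represented U (\sum_(k < m) M k) (fun phi => phi (x m) - phi (x 0%N)).
Proof.
move=> mU; elim: m => [|m IH] H.
  rewrite big_ord0; apply: eq_represented (represented0 U (lexx 0)) => phi.
  by rewrite subrr.
rewrite big_ord_recr/=; apply: (represented_trans mU (IH _)) => [k km|].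
  by apply: H; exact: ltnW.
exact: H.
Qed.

(** Changing one coordinate at a time leads from x to y inside the box that they
    span, in n steps of length at most [enorm (y - x)]. *)
Lemma represented_box U (x y : 'rV[R]_n) : measurable U ->
  (forall z : 'rV[R]_n, (forall j, `|z ord0 j - x ord0 j| <= `|y ord0 j - x ord0 j|) -> ~ U z) ->
  represented U (n%:R * enorm (y - x)) (fun phi => phi y - phi x).
Proof.
move=> mU nU.
pose z k : 'rV[R]_n := \row_j (if (j < k)%N then y ord0 j else x ord0 j).
have zn : z n = y by apply/rowP => j; rewrite mxE ltn_ord.
have z0 : z 0%N = x by apply/rowP => j; rewrite mxE.
have := @represented_chain U z (fun=> enorm (y - x)) n mU.
rewrite zn z0 sumr_const card_ord mulr_natl; apply => k kn.
pose i := Ordinal kn; pose c := y ord0 i - x ord0 i.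
have zS : z k.+1 = z k + c *: e_ i.
  apply/rowP => j; rewrite !mxE eqxx/=; have [->|ji] := eqVneq j i.
    by rewrite ltnSn ltnn mulr1 /c addrC subrK.
  have jk : (j == k :> nat) = false by exact/negbTE.
  by rewrite ltnS leq_eqVlt jk/= mulr0 addr0.
rewrite zS; apply: (@representedW _ _ _ `|c|).
  by have := coord_le_enorm (y - x) i; rewrite !mxE.
apply: represented_axis => // t tc _; apply: nU => j; rewrite !mxE eqxx/=.
have [->|ji] := eqVneq j i; first by rewrite ltnn mulr1 addrAC subrr add0r.
by rewrite mulr0 addr0; case: ifP => // _; rewrite subrr normr0.
Qed.

End staircase.

Section quasiconvex.
Context {R : realType} {n : nat}.
Implicit Types (U V : set 'rV[R]_n).

(** The norm of row vectors is the sup norm: its balls are cubes. *)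
Lemma normr_coord_le (x : 'rV[R]_n) (c : R) : 0 <= c ->
  (`|x| <= c) <-> (forall j, `|x ord0 j| <= c).
Proof.
move=> c0; rewrite /Num.norm/= mx_normrE; split=> [/bigmax_leP[_ H] j|H].
  by have := H (ord0, j) isT.
by apply/bigmax_leP; split => // -[i j] _ /=; rewrite (ord1 i); exact: H.
Qed.

Lemma normr_le_dominated (x y : 'rV[R]_n) : (forall j, `|x ord0 j| <= `|y ord0 j|) -> `|x| <= `|y|.
Proof.
move=> xy; apply/normr_coord_le => // j; apply: le_trans (xy j) _.
exact/(normr_coord_le y (normr_ge0 _)).1.
Qed.

(** The box spanned by g t and g t' is small when t' is close to t, hence contained
    in V; compactness of [0, 1] makes this uniform in t.  It allows an inscribed
    polygon to be replaced by staircases that remain in V. *)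
Lemma path_box_uniform V (g : R -> 'rV[R]_n) : open V ->
  {within `[0, 1], continuous g} -> (forall t, 0 <= t <= 1 -> V (g t)) ->
  exists2 h : R, 0 < h & forall t t', 0 <= t <= 1 -> 0 <= t' <= 1 -> `|t' - t| <= h ->
    forall z : 'rV[R]_n,
    (forall j, `|z ord0 j - g t ord0 j| <= `|g t' ord0 j - g t ord0 j|) -> V z.
Proof.
move=> oV cg Vg.
pose P (h : R) (t : R) := forall t', 0 <= t' <= 1 -> `|t' - t| <= h ->
    forall z : 'rV[R]_n,
    (forall j, `|z ord0 j - g t ord0 j| <= `|g t' ord0 j - g t ord0 j|) -> V z.
have cov : near_covering_within (`[0, 1]%classic : set R).
  by apply/near_covering_withinP/compact_near_coveringP; exact: segment_compact.
have loc (t0 : R) : `[0, 1]%classic t0 ->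
    \forall t \near t0 & h \near 0^'+, `[0, 1]%classic t -> P h t.
  move=> It0; have Vt0 : nbhs (g t0) V.
    by apply: open_nbhs_nbhs; split => //; apply: Vg; move: It0; rewrite /= in_itv.
  have [r /= r0 rV] := (nbhs_ballP (g t0) V).1 Vt0.
  have /subspace_continuousP/(_ t0 It0) cgt0 := cg.
  have r4 : 0 < r / 4 by rewrite divr_gt0.
  have /cvgrPdist_lt/(_ _ r4) := cgt0.
  rewrite near_withinE => /nbhs_ballP[eta /= eta0 etaP].
  have eta2 : 0 < eta / 2 by rewrite divr_gt0.
  near=> t h; move=> It t' It' t't z zt.
  have t0t : `|t0 - t| < eta / 2.
    by near: t; have := @near_ball R R t0 _ eta2; apply: filterS => u; rewrite /ball/=.
  have hlt : h < eta / 2 by near: h; exact: nbhs_right_lt.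
  have gt_ : `|g t0 - g t| < r / 4.
    apply: etaP => //; suff : `|t0 - t| < eta by [].
    by apply: lt_le_trans t0t _; rewrite [leRHS]splitr lerDl ltW.
  have gt'_ : `|g t0 - g t'| < r / 4.
    apply: etaP; last by rewrite in_itv.
    suff : `|t0 - t'| < eta by [].
    apply: le_lt_trans (ler_distD t t0 t') _; rewrite (distrC t t').
    by rewrite [ltRHS]splitr ltrD// (le_lt_trans t't).
  apply: rV; rewrite -ball_normE /ball_/=.
  have zt_ : `|z - g t| <= `|g t' - g t|.
    by apply: normr_le_dominated => j; have := zt j; rewrite !mxE.
  have d1 := ler_distD (g t) (g t0) z; have d2 := ler_distD (g t0) (g t') (g t).
  rewrite (distrC (g t) z) in d1; rewrite (distrC (g t') (g t0)) in d2.
  have d3 := le_lt_trans d2 (ltrD gt'_ gt_).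
  have d4 := le_lt_trans d1 (ltrD gt_ (le_lt_trans zt_ d3)).
  by apply: lt_trans d4 _; lra.
have {cov} H : \forall h \near (0:R)^'+, `[0, 1]%classic `<=` P h.
  exact: (cov R (0^'+) P _ loc).
near (0 : R)^'+ => h; exists h; first by near: h; exact: nbhs_right_gt.
move=> t t' It It' tt' z zt; have Ph : `[0, 1]%classic `<=` P h by near: h.
by apply: (Ph t _ t') => //; rewrite /= in_itv.
Unshelve. all: by end_near. Qed.

(** A staircase over the step from g (t k) to g (t k.+1) costs n times the length of
    that step, and the length of an inscribed polygon is at most that of g. *)
Lemma represented_path (U : set (borelRn R n)) V (g : R -> 'rV[R]_n) (L : R) :
  measurable U -> open V -> (forall x, V x -> ~ U x) ->
  {within `[0, 1], continuous g} -> (forall t, 0 <= t <= 1 -> V (g t)) ->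
  (curve_length 0 1 g <= L%:E)%E ->
  represented U (n%:R * L) (fun phi => phi (g 1) - phi (g 0)).
Proof.
move=> mU oV VU cg Vg gL.
have [h h0 hP] := path_box_uniform oV cg Vg.
pose N := (Num.truncn h^-1).+1.
have N0 : 0 < N%:R :> R by rewrite ltr0n.
have Nh : N%:R^-1 <= h.
  rewrite -[h]invrK lef_pV2 ?posrE ?invr_gt0// ltW//.
  exact: (truncnS_gt h^-1).
pose t k : R := k%:R / N%:R.
pose s := [seq t k.+1 | k <- iota 0 N].
have ss : size s = N by rewrite size_map size_iota.
have sE k : (k <= N)%N -> nth 1 (0 :: s) k = t k.
  case: k => [|k] kN /=; first by rewrite /t mul0r.
  by rewrite (nth_map 0%N) ?size_iota// nth_iota.
have t_ltS k : t k < t k.+1 by rewrite /t ltr_pM2r ?invr_gt0// ltr_nat.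
have sP : itv_partition 0 1 s.
  split; last by rewrite (last_nth 1) ss sE// /t divff// gt_eqF.
  apply/(pathP 1) => k; rewrite ss => kN; rewrite [X in _ < X](_ : _ = nth 1 (0 :: s) k.+1)//.
  by rewrite !sE// ltnW.
have len : \sum_(k < N) enorm (g (t k.+1) - g (t k)) <= L.
  rewrite -lee_fin; apply: le_trans gL; apply: ereal_sup_ubound; exists s; first exact: sP.
  rewrite ss big_mkord; congr EFin; apply: eq_bigr => k _.
  have := sE k.+1 (ltn_ord k); have := sE k (ltnW (ltn_ord k)).
  by move=> /= -> ->.
apply: (@representedW _ _ _ (\sum_(k < N) n%:R * enorm (g (t k.+1) - g (t k)))).
  by rewrite -mulr_sumr ler_wpM2l.
have tN : t N = 1 by rewrite /t divff// gt_eqF.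
have t0 : t 0%N = 0 by rewrite /t mul0r.
have := @represented_chain _ _ U (g \o t) (fun k => n%:R * enorm (g (t k.+1) - g (t k))) N mU.
rewrite /= tN t0; apply => k kN.
have tI k' : (k' <= N)%N -> 0 <= t k' <= 1.
  move=> kN'; rewrite /t divr_ge0//= ler_pdivrMr// mul1r ler_nat.
  exact: kN'.
apply: represented_box => // z zP Uz; apply: (VU z) => //.
apply: (hP (t k) (t k.+1)) => //; [by apply: tI; exact: ltnW|exact: tI|].
by rewrite /t -mulrBl -natrB// subSnn mul1r ger0_norm.
Qed.

Lemma enorm_le_norm (x : 'rV[R]_n) : enorm x <= n.+1%:R * `|x|.
Proof.
apply: le_trans (enorm_le_sum x) _.
apply: (@le_trans _ _ (\sum_(i < n) `|x|)).
  by apply: ler_sum => i _; exact: (normr_coord_le x (normr_ge0 x)).1.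
by rewrite sumr_const card_ord -[leLHS]mulr_natl ler_wpM2r// ler_nat.
Qed.

(** The curves given by quasiconvexity may be used for points of the open set itself,
    where even the end points are off the closure of U.  The constants absorb the
    passage from the Euclidean norm to the sup norm. *)
Lemma quasiconvex_represented (U : set 'rV[R]_n) : open U ->
  locally_uniformly_quasiconvex (~` closure U) ->
  exists K delta : R, [/\ 0 < K, 0 < delta & forall p q : 'rV[R]_n,
    ~ closure U p -> ~ closure U q -> `|p - q| < delta ->
    represented (U : set (borelRn R n)) (K * `|p - q|) (fun phi => phi q - phi p)].
Proof.
move=> oU [eps [delta [eps0 delta0 qc]]].
have n0 : 0 < n.+1%:R :> R by rewrite ltr0n.
exists (n.+1%:R * (eps^-1 * n.+1%:R)), (delta / n.+1%:R); split.
- by rewrite !mulr_gt0 ?invr_gt0.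
- by rewrite divr_gt0.
move=> p q Up Uq pq.
have mU : measurable (U : set (borelRn R n)) by exact: open_measurableRn.
have [->|/eqP npq] := eqVneq p q.
  apply: eq_represented (represented0 _ _); first by move=> phi; rewrite subrr.
  by rewrite !mulr_ge0// ?invr_ge0 ltW.
have epq : enorm (p - q) < delta.
  apply: le_lt_trans (enorm_le_norm _) _.
  by rewrite mulrC -ltr_pdivlMr.
have oV : open (~` closure U) by apply/closed_openC/closed_closure.
have [g [cg g0 g1 gV [_ gL]]] := qc _ _ (subset_closure Up) (subset_closure Uq) npq epq.
have gV' t : 0 <= t <= 1 -> (~` closure U) (g t).
  case/andP; rewrite le_eqVlt => /predU1P[<- _|t0]; first by rewrite g0.
  rewrite le_eqVlt => /predU1P[->|t1]; first by rewrite g1.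
  by apply: gV; rewrite t0.
have := represented_path mU oV _ cg gV' gL; rewrite g0 g1.
move=> /(_ _)/representedW; apply.
  rewrite -!mulrA; apply: ler_pM => //.
  - by rewrite mulr_ge0 ?invr_ge0 ?enorm_ge0 ?ltW.
  - by rewrite ler_nat.
  by rewrite ler_pM2l ?invr_gt0// enorm_le_norm.
by move=> x nUx Ux; apply: nUx; exact: subset_closure.
Qed.

End quasiconvex.

(** * A Whitney covering *)

Lemma normr_coord_lt {R : realType} {n : nat} (x : 'rV[R]_n) (c : R) : 0 < c ->
  (forall j, `|x ord0 j| < c) -> `|x| < c.
Proof.
move=> c0 H; rewrite /Num.norm/= mx_normrE.
by apply/bigmax_ltP; split => // -[i j] _ /=; rewrite (ord1 i); exact: H.
Qed.

Section whitney.
Context {R : realType} {n : nat}.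
Variables (U : set 'rV[R]_n) (s0 : R).
Hypothesis (openU : open U) (s0_gt0 : 0 < s0).

(** The index (l, m) stands for the cube of radius r l = s0 / 2^l centred at the
    point r l m of a lattice. *)
Let index := (nat * 'rV[int]_n)%type.
Let r (l : nat) : R := s0 * 2^-1 ^+ l.
Let c (i : index) : 'rV[R]_n := \row_a ((i.2 ord0 a)%:~R * r i.1).

Let r_gt0 l : 0 < r l.
Proof. by rewrite mulr_gt0// exprn_gt0// invr_gt0. Qed.

Let r_le l : r l <= s0.
Proof. by rewrite /r ler_piMr ?(ltW s0_gt0)// exprn_ile1// ?invr_ge0// invf_le1// ler1n. Qed.

(** The tripled cube lies in U, with room for a bump supported in the doubled cube.
    Below the largest scale the cube also sees a point off U within 9 radii. *)
Let admissible (i : index) := `[< (forall y, `|y - c i| <= 3 * r i.1 -> U y) /\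
  (i.1 = 0%N \/ exists2 y, ~ U y & `|y - c i| <= 9 * r i.1) >].

Let active (i : index) x := admissible i && (`|x - c i| <= 2 * r i.1).

(** If 11 r_k <= r_i, a point off U within 9 r_k of c k would be within
    9 r_k + 2 r_k + 2 r_i <= 3 r_i of c i. *)
Let active_r i k x : active i x -> active k x -> r i.1 < 11 * r k.1.
Proof.
move=> /andP[/asboolP[Bi _] xi] /andP[/asboolP[_ [k0|[y Uy yk]]] xk].
  rewrite k0; apply: le_lt_trans (r_le _) _; rewrite /r expr0 mulr1.
  have := s0_gt0; lra.
rewrite ltNge; apply/negP => h; apply: Uy; apply: Bi.
have := ler_distD (c k) y (c i); have := ler_distD x (c k) (c i).
rewrite (distrC (c k) x); lra.
Qed.

(** Since 11 < 2^4. *)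
Let active_lev i k x : active i x -> active k x -> (k.1 < i.1 + 4)%N.
Proof.
move=> ai ak; have := active_r ai ak; rewrite ltnNge; apply: contraTN => /subnKC <-.
rewrite -leNgt /r !exprD.
have := s0_gt0; have : 0 < 2^-1 ^+ i.1 :> R by rewrite exprn_gt0// invr_gt0.
have : 0 <= (2^-1 : R) ^+ (k.1 - (i.1 + 4)) <= 1.
  by rewrite exprn_ge0 ?invr_ge0//= exprn_ile1// ?invr_ge0// invf_le1// ler1n.
have -> : (2^-1 : R) ^+ 4 = 1/16 by field.
set u := _ ^+ _; set v := _ ^+ _ => /andP[u0 u1] v0 s1.
have su : 0 < s0 * v by rewrite mulr_gt0.
have : s0 * v * u <= s0 * v by rewrite ler_piMr// ltW.
have -> : 11 * (s0 * (v * (1 / 16) * u)) = 11 / 16 * (s0 * v * u) by ring.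
lra.
Qed.

(** The position of the lattice point of a cube relative to x: five values in each
    coordinate suffice for the cubes that are active at x. *)
Let dig (x : 'rV[R]_n) (i : index) : {ffun 'I_n -> 'I_5} :=
  [ffun a => inord `|(i.2 ord0 a - Num.floor (x ord0 a / r i.1) + 2)%R|%N].

Let dig_bound x i a : active i x ->
  0 <= i.2 ord0 a - Num.floor (x ord0 a / r i.1) + 2 < 5.
Proof.
move=> /andP[_]; have r0 := r_gt0 i.1.
have r2 : 0 <= 2 * r i.1 by rewrite mulr_ge0// ltW.
move=> /(normr_coord_le _ r2)/(_ a); rewrite !mxE.
set q := x ord0 a / _; have -> : x ord0 a = q * r i.1 by rewrite divfK// gt_eqF.
rewrite -mulrBl normrM (gtr0_norm r0) ler_pM2r// ler_norml => /andP[h1 h2].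
have f1 : (Num.floor q)%:~R <= q by exact: floor_le_tmp.
have f2 : q < (Num.floor q)%:~R + 1 by rewrite -intrD1; exact: floorD1_gt.
set f := Num.floor q in f1 f2 *; set m := i.2 ord0 a in h1 h2 *.
apply/andP; split.
  rewrite -ltzD1 -(ltr_int R) !intrD intrN /=; lra.
rewrite -(ltr_int R) !intrD intrN; lra.
Qed.

(** An active cube is determined by its level, for which there are at most nine
    possibilities, and by its digits. *)
Let active_count x J :
  (count (fun j => if pickle_inv j is Some i then active i x else false) (iota 0 J)
    <= #|{: 'I_9 * {ffun 'I_n -> 'I_5}}|)%N.
Proof.
set P := fun j => _; rewrite -size_filter.
case E : (seq.filter P (iota 0 J)) => [|j0 s]; first by [].
have : j0 \in seq.filter P (iota 0 J) by rewrite E mem_head.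
rewrite mem_filter => /andP[+ _]; rewrite {1}/P.
case: pickle_inv => // i0 ai0; rewrite -E.
pose f j : 'I_9 * {ffun 'I_n -> 'I_5} :=
  if pickle_inv j is Some i then (inord (i.1 + 4 - i0.1), dig x i) else (ord0, [ffun=> ord0]).
rewrite -(size_map f) cardE; apply: uniq_leq_size; last by move=> z _; rewrite mem_enum.
rewrite map_inj_in_uniq ?filter_uniq ?iota_uniq// => j k.
rewrite !mem_filter => /andP[Pj _] /andP[Pk _].
move: Pj Pk; rewrite /P /f.
case Ej : (pickle_inv j) => [i|//]; case Ek : (pickle_inv k) => [i'|//] ai ai' [].
have [h1 h2] := (active_lev ai0 ai, active_lev ai ai0).
have [h1' h2'] := (active_lev ai0 ai', active_lev ai' ai0).
move=> /(congr1 val)/=; rewrite !inordK; [|lia|lia] => el.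
have subI (p q s' : nat) : (s' < p + 4)%N -> (s' < q + 4)%N ->
  (p + 4 - s' = q + 4 - s')%N -> p = q by lia.
have {}el : i.1 = i'.1 := subI _ _ _ h2 h2' el.
move=> ed; have em : i.2 = i'.2.
  apply/rowP => a; have := congr1 (fun g : {ffun 'I_n -> 'I_5} => val (g a)) ed.
  have /andP[b1 b2] := dig_bound a ai; have /andP[b1' b2'] := dig_bound a ai'.
  have lt5 (z : int) : 0 <= z -> z < 5 -> (`|z|%N < 5)%N by lia.
  rewrite /= !ffunE !inordK ?lt5// -el => /(congr1 Posz); rewrite !gez0_abs//; last first.
    by rewrite el.
  by move=> /addIr/addIr.
have ii' : i = i' by rewrite (surjective_pairing i) el em -surjective_pairing.
have := @pickle_invK index j; have := @pickle_invK index k.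
by rewrite Ej Ek /= ii' => -> ->.
Qed.

(** Take the first level at which the ball of radius 4 r about x is in U.  At the
    previous level there is a point off U within 8 r of x, hence within 9 r of the
    centre of a lattice cube containing x. *)
Let covering x : U x -> exists i, admissible i /\ `|x - c i| < r i.1.
Proof.
move=> Ux.
have ex : exists l, `[< forall y, `|y - x| <= 4 * r l -> U y >].
  have /(nbhs_ballP x U)[e /= e0 eU] : nbhs x U by exact: open_nbhs_nbhs.
  have : (fun l => 4 * r l) @ \oo --> (0 : R).
    have -> : (fun l => 4 * r l) = geometric (4 * s0) 2^-1.
      by apply/funext => l; rewrite /geometric/= mulrA.
    by apply: cvg_geometric; rewrite ger0_norm ?invr_ge0// invf_lt1// ltr1n.
  move=> /cvgrPdist_lt/(_ _ e0)[l _ /(_ l (leqnn _))].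
  rewrite /= sub0r normrN ger0_norm ?mulr_ge0 ?ltW// => le.
  exists l; apply/asboolP => y yx; apply: eU; rewrite -ball_normE/=.
  by rewrite distrC (le_lt_trans yx).
case: (ex_minnP ex) => l /asboolP lU lmin.
have r0 := r_gt0 l.
pose m : 'rV[int]_n := \row_a Num.floor (x ord0 a / r l).
have xc : `|x - c (l, m)| < r l.
  apply: normr_coord_lt => // a; rewrite !mxE; set q := x ord0 a / _.
  have -> : x ord0 a = q * r l by rewrite divfK// gt_eqF.
  rewrite -mulrBl normrM (gtr0_norm r0) gtr_pMl//.
  have f1 : (Num.floor q)%:~R <= q by exact: floor_le_tmp.
  have f2 : q < (Num.floor q)%:~R + 1 by rewrite -intrD1; exact: floorD1_gt.
  rewrite ltr_norml; lra.
exists (l, m); split => //; apply/asboolP; split.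
  move=> y yc; apply: lU; have := ler_distD (c (l, m)) y x.
  rewrite (distrC (c _) x) /= in yc *; lra.
case: l lmin lU r0 m xc => [|l] lmin lU r0 m xc; first by left.
right; have : ~ (forall y, `|y - x| <= 4 * r l -> U y).
  by move=> h; have := lmin l (introT (asboolP _) h); rewrite ltnn.
move=> /existsNP[y /not_implyP[yx nUy]]; exists y => //.
have rS : r l = 2 * r l.+1 by rewrite /r exprS; field.
have := ler_distD x y (c (l.+1, m)); rewrite /= in xc *; rewrite rS in yx; lra.
Qed.

(** The cubes are numbered through the countability of [index]; [val] discards the
    numbers that do not encode an admissible cube. *)
Lemma whitney_covering : exists (cen : nat -> 'rV[R]_n) (rad : nat -> R) (val : nat -> bool) (N : nat),
  let act j x := val j && (`|x - cen j| <= 2 * rad j) in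
  [/\ forall j, 0 < rad j <= s0,
      forall j y, val j -> `|y - cen j| <= 3 * rad j -> U y,
      forall x, U x -> exists2 j, val j & `|x - cen j| < rad j,
      forall j, val j -> rad j = s0 \/ exists2 y, ~ U y & `|y - cen j| <= 9 * rad j &
      (forall j k x, act j x -> act k x -> rad j <= 11 * rad k) /\
      forall x J, (count (act ^~ x) (iota 0 J) <= N)%N].
Proof.
pose dec (A : Type) (f : index -> A) (z : A) (j : nat) := if pickle_inv j is Some i then f i else z.
exists (dec _ c 0), (dec _ (r \o fst) s0), (dec _ admissible false), #|{: 'I_9 * {ffun 'I_n -> 'I_5}}|.
move=> act.
have actE j x : act j x = if pickle_inv j is Some i then active i x else false.
  by rewrite /act /dec; case: pickle_inv.
split.
- by move=> j; rewrite /dec; case: pickle_inv => [i|]; rewrite ?r_gt0 ?r_le ?s0_gt0 ?lexx.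
- by move=> j y; rewrite /dec; case: pickle_inv => // i /asboolP[+ _]; exact.
- move=> x /covering[i [ai xi]]; exists (pickle i); by rewrite /dec pickleK_inv.
- move=> j; rewrite /dec; case: pickle_inv => // i /asboolP[_ [i0|[y Uy yi]]]; last by right; exists y.
  by left; rewrite /= i0 /r expr0 mulr1.
split=> [j k x|x J].
  rewrite !actE /dec; case: pickle_inv => // i; case: pickle_inv => // i' ai ai'.
  exact: ltW (active_r ai ai').
by rewrite (eq_count (actE ^~ x)) active_count.
Qed.

End whitney.

(** * A Whitney partition of unity *)

Section partition_of_unity.
Context {R : realType} {n : nat}.
Variables (U : set 'rV[R]_n) (cen : nat -> 'rV[R]_n) (rad : nat -> R) (val : nat -> bool) (N : nat).
Let act j x := val j && (`|x - cen j| <= 2 * rad j).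
Hypothesis rad_gt0 : forall j, 0 < rad j.
Hypothesis val_U : forall j y, val j -> `|y - cen j| <= 3 * rad j -> U y.
Hypothesis covering : forall x, U x -> exists2 j, val j & `|x - cen j| < rad j.
Hypothesis act_rad : forall j k x, act j x -> act k x -> rad j <= 11 * rad k.
Hypothesis act_count : forall x J, (count (act ^~ x) (iota 0 J) <= N)%N.
Implicit Types (i : 'I_n) (j k J : nat) (x : 'rV[R]_n).

Let psi j x : R := if val j then cube_bump ((rad j)^-1 *: (x - cen j)) else 0.
Let Q J x : R := \prod_(j <- iota 0 J) (1 - psi j x).
(** As chi j = Q j - Q j.+1, the partial sums telescope to 1 - Q J and no division
    by a sum of bumps is needed. *)
Definition whitney_chi j x : R := psi j x * Q j x.
Local Notation chi := whitney_chi.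

Let psi01 j x : 0 <= psi j x <= 1.
Proof. by rewrite /psi; case: ifP; rewrite ?lexx ?ler01// bump_ge0 bump_le1. Qed.

Let Ck_psi m j : Ck m (psi j).
Proof.
rewrite /psi; case: val; last exact: Ck_cst.
by apply: Ck_affine; apply: (smoothP _).1; exact: smooth_bump.
Qed.

Let CkB m (f : 'rV[R]_n -> R) : Ck m f -> Ck m (fun x => 1 - f x).
Proof.
move=> Cf; have -> : (fun x => 1 - f x) = fun x => cst 1 x + cst (-1) x * f x.
  by apply/funext => x; rewrite /= mulN1r.
by apply: CkD; [exact: Ck_cst|apply: CkM => //; exact: Ck_cst].
Qed.

Let Ck_Q m J : Ck m (Q J).
Proof. by apply: Ck_prod => j; apply: CkB; exact: Ck_psi. Qed.

Lemma smooth_chi j : smooth (chi j).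
Proof. by apply/smoothP => m; apply: CkM; [exact: Ck_psi|exact: Ck_Q]. Qed.

Let dpsi j i x : derivable (psi j) x (delta_mx ord0 i).
Proof. by have [_ /(_ i)[]] := Ck_psi 1 j. Qed.

Let dQ j i x : derivable (Q j) x (delta_mx ord0 i).
Proof. by have [_ /(_ i)[]] := Ck_Q 1 j. Qed.

Let QS J x : Q J.+1 x = Q J x - chi J x.
Proof.
rewrite /Q /chi -addn1 iotaD add0n big_cat/= big_cons big_nil mulr1 -/(Q J x).
ring.
Qed.

Let Q01 J x : 0 <= Q J x <= 1.
Proof.
rewrite /Q; elim: (iota 0 J) => [|j s /andP[IH0 IH1]]; first by rewrite big_nil ler01 lexx.
rewrite big_cons; have /andP[p0 p1] := psi01 j x.
by rewrite mulr_ge0 ?subr_ge0// mulr_ile1// ?subr_ge0// gerBl.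
Qed.

Lemma sum_chi J x : \sum_(j < J) chi j x = 1 - Q J x.
Proof.
elim: J => [|J IH]; first by rewrite big_ord0 /Q big_nil subrr.
by rewrite big_ord_recr/= IH QS; ring.
Qed.

Lemma chi_ge0 j x : 0 <= chi j x.
Proof. by have /andP[p0 _] := psi01 j x; have /andP[q0 _] := Q01 j x; rewrite mulr_ge0. Qed.

Lemma sum_chi_le1 J x : \sum_(j < J) chi j x <= 1.
Proof. by rewrite sum_chi; have /andP[q0 _] := Q01 J x; lra. Qed.

Let psi_act j x : ~~ act j x -> psi j x = 0 /\ forall i, partial i (psi j) x = 0.
Proof.
rewrite /act /psi negb_and; case: val => //= [|_]; last first.
  by split=> // i; rewrite /partial derive_cst.
rewrite -ltNge => h; have r0 := rad_gt0 j.
have [a ha] : exists a, 2 < `|((rad j)^-1 *: (x - cen j)) ord0 a|.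
  apply: contrapT => /forallNP nh; move: h; apply/negP; rewrite -leNgt.
  have r2 : 0 <= 2 * rad j by rewrite mulr_ge0// ltW.
  apply/(normr_coord_le _ r2) => a; have := nh a => /negP; rewrite -leNgt mxE.
  by rewrite normrM (@ger0_norm _ (rad j)^-1) ?invr_ge0 ?(ltW r0)// [_^-1 * _]mulrC ler_pdivrMr.
split; first by apply: (@bump0 _ _ _ a); exact: ltW.
move=> i; rewrite partial_affine; last by move=> y; apply: smooth_derivable; exact: smooth_bump.
by rewrite (partial_bump0 _ ha) mulr0.
Qed.

Let partial_chi i j x :
  partial i (chi j) x = psi j x * partial i (Q j) x + Q j x * partial i (psi j) x.
Proof. by rewrite /partial deriveM. Qed.

Lemma chi_act j x : ~~ act j x -> chi j x = 0 /\ forall i, partial i (chi j) x = 0.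
Proof.
move=> /psi_act[p0 dp0]; split; first by rewrite /chi p0 mul0r.
by move=> i; rewrite partial_chi p0 dp0 mul0r mulr0 addr0.
Qed.

Lemma chi_test j : test_function U (chi j).
Proof.
pose K := [set x : 'rV[R]_n | val j /\ `|x - cen j| <= 2 * rad j].
have cK : closed K.
  have [vj|/negP vj] := boolP (val j); last first.
    by rewrite (_ : K = set0); [exact: closed0|apply/seteqP; split=> x // -[]].
  rewrite (_ : K = [set x | `|x - cen j| <= 2 * rad j]); last first.
    by apply/seteqP; split=> x // -[].
  have cn : continuous (fun x : 'rV[R]_n => `|x - cen j|).
    move=> x; have cB : (fun y : 'rV[R]_n => y - cen j) @ x --> x - cen j.
      exact: cvgB cvg_id (cvg_cst _).
    exact: (cvg_norm cB).
  have := @preimage_closed _ _ (fun x : 'rV[R]_n => `|x - cen j|) [set y : R | y <= 2 * rad j].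
  by apply; [move=> x _; exact: cn|exact: closed_le].
have sub : closure [set x | chi j x != 0] `<=` K.
  rewrite closureE; apply: smallest_sub => // x /= /eqP cx.
  by apply/andP; apply: contrapT => /negP /chi_act[].
split; first exact: smooth_chi.
- apply: (subclosed_compact _ _ sub); first exact: closed_closure.
  apply: bounded_closed_compact => //.
  exists (`|cen j| + 2 * rad j); split; first exact: num_real.
  move=> M CM x [_ xj] /=; apply: le_trans (ltW CM).
  by have := ler_normD (cen j) (x - cen j); rewrite addrC subrK; lra.
- move=> x /sub[vj xj]; apply: (val_U vj); apply: le_trans xj _.
  by rewrite ler_pM2r// ler_nat.
Qed.

(** The number of active indices below J is bounded, so it is constant from some J
    on. *)
Lemma act_finite x : exists J0, forall j, (J0 <= j)%N -> ~~ act j x.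
Proof.
pose P m := `[< exists J, count (act ^~ x) (iota 0 J) = m >].
have exP : exists m, P m by exists 0%N; apply/asboolP; exists 0%N.
have Pub m : P m -> (m <= N)%N by move=> /asboolP[J <-].
case: (ex_maxnP exP Pub) => m /asboolP[J Jm] mmax.
exists J => j Jj; apply/negP => aj.
have /mmax : P (count (act ^~ x) (iota 0 j.+1)) by apply/asboolP; exists j.+1.
have c1 : count (act ^~ x) (iota 0 j.+1) = (count (act ^~ x) (iota 0 j)).+1.
  by rewrite -addn1 iotaD count_cat /= ?add0n aj addn0 addn1.
have c2 : (count (act ^~ x) (iota 0 J) <= count (act ^~ x) (iota 0 j))%N.
  by rewrite -[in leqRHS](subnKC Jj) iotaD count_cat leq_addr.
by rewrite c1 -Jm ltnNge c2.
Qed.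

(** Once the product contains the factor of a bump equal to 1 near x, it vanishes
    near x, and so do its partials. *)
Lemma chi_partition x : U x -> exists J0, forall J, (J0 <= J)%N ->
  \sum_(j < J) chi j x = 1 /\ forall i, \sum_(j < J) partial i (chi j) x = 0.
Proof.
move=> /covering[j0 vj0 xj0]; exists j0.+1 => J j0J.
have Q0 y : `|y - cen j0| < rad j0 -> Q J y = 0.
  move=> yj0; rewrite /Q (big_rem j0)/=; last by rewrite mem_iota.
  rewrite /psi vj0 bump1 ?subrr ?mul0r// => a; rewrite mxE normrM.
  have r0 := rad_gt0 j0; rewrite (@ger0_norm _ (rad j0)^-1) ?invr_ge0 ?(ltW r0)// mulrC ler_pdivrMr// mul1r.
  by apply: (normr_coord_le _ (ltW r0)).1; exact: ltW.
split; first by rewrite sum_chi Q0// subr0.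
move=> i; have Qs : partial i (Q J) x = 0.
  rewrite /partial (@near_eq_derive _ _ _ _ (cst 0)) ?derive_cst//.
  have e0 : 0 < rad j0 - `|x - cen j0| by rewrite subr_gt0.
  apply/nbhs_ballP; exists (rad j0 - `|x - cen j0|) => // y.
  rewrite -ball_normE /ball_/= => xy; apply: Q0.
  by have := ler_distD x y (cen j0); rewrite (distrC y x); lra.
have -> : \sum_(j < J) partial i (chi j) x = - partial i (Q J) x.
  elim: J {j0J Q0 Qs} => [|J IH].
    rewrite big_ord0 (_ : Q 0 = cst 1); last by apply/funext => y; rewrite /Q big_nil.
    by rewrite /partial derive_cst oppr0.
  rewrite big_ord_recr/= IH (_ : Q J.+1 = Q J - chi J); last by apply/funext => y; rewrite QS.
  rewrite /partial deriveB ?opprB 1?addrC//; apply: smooth_derivable; exact: smooth_chi.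
by rewrite Qs oppr0.
Qed.

(** The bumps active at x have radius at least [rad k / 11] and are at most N in
    number.  All factors of the product lie between 0 and 1, so its partials are
    bounded by the sum of those of the bumps. *)
Lemma partial_chi_bound : exists2 C : R, 0 < C &
  forall J k i x, act k x -> \sum_(j < J) `|partial i (chi j) x| <= C / rad k.
Proof.
have [B B0 HB] := @partial_bump_bounded R n.
pose D := 11 * B.
have D0 : 0 < D by rewrite mulr_gt0.
exists ((1 + N%:R) * (N%:R * D) + 1); first by rewrite ltr_wpDl// !mulr_ge0 ?addr_ge0// ltW.
move=> J k i x ak; have rk := rad_gt0 k.
pose d j := `|partial i (psi j) x|.
have dle j : d j <= (act j x)%:R * (D / rad k).
  rewrite /d; have [aj|/psi_act[_ ->]] := boolP (act j x); last by rewrite normr0 mul0r.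
  rewrite mul1r /psi; have [vj _] := andP aj; rewrite vj.
  rewrite partial_affine; last by move=> y; apply: smooth_derivable; exact: smooth_bump.
  have rj := rad_gt0 j; rewrite normrM (@ger0_norm _ (rad j)^-1) ?invr_ge0 ?(ltW rj)//.
  rewrite ler_pdivlMr//; apply: (@le_trans _ _ (B / rad j * rad k)).
    by rewrite ler_pM2r// mulrC ler_pM2r ?invr_gt0//; exact: HB.
  rewrite /D mulrAC ler_pdivrMr// [B * _]mulrC [leRHS]mulrAC ler_pM2r//.
  exact: act_rad ak aj.
have sact (c : R) : 0 <= c -> \sum_(j < J) (act j x)%:R * c <= N%:R * c.
  move=> c0; rewrite -mulr_suml ler_wpM2r// -natr_sum ler_nat.
  apply: leq_trans (act_count x J); rewrite -sum1_count.
  rewrite -[in leqRHS](subn0 J) -/(index_iota 0 J) big_mkord [leqRHS]big_mkcond/=.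
  by apply: leq_sum => j _; case: (act j x).
have Dk0 : 0 <= D / rad k by rewrite divr_ge0// ltW.
have dsum : \sum_(j < J) d j <= N%:R * (D / rad k).
  by apply: le_trans (sact _ Dk0); apply: ler_sum.
have psum : \sum_(j < J) psi j x <= N%:R.
  rewrite -[leRHS]mulr1; apply: le_trans (sact _ ler01); apply: ler_sum => j _.
  have [aj|/psi_act[-> _]] := boolP (act j x); last by rewrite mul0r.
  by rewrite mulr1; have /andP[] := psi01 j x.
have Qle j : `|partial i (Q j) x| <= \sum_(l < j) d l.
  elim: j => [|j IH].
    rewrite big_ord0 (_ : Q 0 = cst 1); last by apply/funext => y; rewrite /Q big_nil.
    by rewrite /partial derive_cst normr0.
  rewrite big_ord_recr/= (_ : Q j.+1 = Q j - chi j); last by apply/funext => y; rewrite QS.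
  rewrite {1}/partial deriveB; [|exact: dQ|by apply: smooth_derivable; exact: smooth_chi].
  have := partial_chi i j x; rewrite /partial => ->; rewrite -!/(partial _ _ _).
  have /andP[p0 p1] := psi01 j x; have /andP[q0 q1] := Q01 j x.
  have -> : partial i (Q j) x - (psi j x * partial i (Q j) x + Q j x * partial i (psi j) x) =
     (1 - psi j x) * partial i (Q j) x - Q j x * partial i (psi j) x by ring.
  apply: le_trans (ler_normB _ _) _; rewrite !normrM.
  rewrite (ger0_norm q0) (@ger0_norm _ (1 - psi j x)) ?subr_ge0//.
  apply: lerD; last by rewrite ler_piMl.
  by apply: le_trans IH; rewrite ler_piMl// gerBl.
apply: (@le_trans _ _ (\sum_(j < J) (psi j x * (N%:R * (D / rad k)) + d j))).
  apply: ler_sum => j _; rewrite partial_chi; apply: le_trans (ler_normD _ _) _.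
  have /andP[p0 p1] := psi01 j x; have /andP[q0 q1] := Q01 j x.
  rewrite !normrM (ger0_norm p0) (ger0_norm q0); apply: lerD; last by rewrite ler_piMl.
  rewrite ler_wpM2l//; apply: le_trans (Qle j) _; apply: le_trans dsum.
  rewrite -(big_mkord xpredT d) -(big_mkord xpredT d).
  rewrite [leRHS](@big_cat_nat _ _ _ j)//=; last exact: ltnW.
  by rewrite lerDl; apply: sumr_ge0 => l _; exact: normr_ge0.
rewrite big_split/= -mulr_suml.
apply: le_trans (lerD (ler_wpM2r _ psum) dsum) _; first by rewrite mulr_ge0.
have -> : N%:R * (N%:R * (D / rad k)) + N%:R * (D / rad k) =
  (1 + N%:R) * (N%:R * D) / rad k by ring.
by rewrite ler_pM2r ?invr_gt0// lerDl ler01.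
Qed.

End partition_of_unity.

Section pairing_bound.
Context {R : realType} {n : nat}.
Implicit Types (phi : 'rV[R]_n -> R) (U : set (borelRn R n)).

Lemma jets_bounded phi : test_function setT phi ->
  exists2 B : R, 0 <= B & forall o x, `|jet o phi x| <= B.
Proof.
move=> tphi; have [B HB] := choice (fun o => jet_bounded o tphi).
exists (\big[Num.max/0]_o B o); first exact: bigmax_ge_id.
by move=> o x; apply: le_trans (HB o x) _; exact: le_bigmax.
Qed.

Lemma represented_bound U M L phi (B : R) : 0 <= B -> test_function setT phi ->
  (forall o x, `|jet o phi x| <= B) -> represented (n := n) U M L ->
  `|L phi| <= n.+1%:R * (B * M).
Proof.
move=> B0 tphi HB [nu [cnu ->//]].
apply: le_trans (ler_norm_sum _ _ _) _.
apply: (@le_trans _ _ (\sum_(o : option 'I_n) B * M)); last first.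
  by rewrite sumr_const card_option card_ord -[leLHS]mulr_natl.
apply: ler_sum => o _; have [cM _ _] := cnu o.
apply: le_trans (ler_normB _ _) _.
apply: le_trans (ler_wpM2l B0 cM); rewrite fineD ?fin_num_measure// mulrDr.
have bj := jet_bounded_measurable o tphi.
by apply: lerD; apply: Rintegral_normr_le => //; exact: bj.1.
Qed.

(** The representation of increments by staircases, with no set to be avoided. *)
Lemma test_lipschitz phi : test_function setT phi ->
  exists2 L : R, 0 <= L & forall x y, `|phi y - phi x| <= L * `|y - x|.
Proof.
move=> tphi; have [B B0 HB] := jets_bounded tphi.
exists (n.+1%:R * (B * (n%:R * n.+1%:R))); first by rewrite !mulr_ge0.
move=> x y.
have := represented_box (U := set0) (x := x) (y := y) measurable0 (fun _ _ => id).
move=> /(represented_bound B0 tphi HB)/le_trans; apply.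
rewrite -!mulrA; do 3 (rewrite ler_wpM2l//).
exact: enorm_le_norm.
Qed.

End pairing_bound.

Section whitney_partition.
Context {R : realType} {n : nat}.

(** What the trace formula needs from the partition: [rad j] is comparable with the
    distance of the j-th cube to the complement of U, unless it equals the top scale
    s0; [act j] holds on a set off which chi j and its partials vanish.  The numbers
    2, 9 and 11 come from the dyadic construction. *)
Record whitney_partition (U : set 'rV[R]_n) (s0 C : R) (chi : nat -> 'rV[R]_n -> R)
    (cen : nat -> 'rV[R]_n) (rad : nat -> R) (act : nat -> 'rV[R]_n -> bool) : Prop := {
  wp_C : 0 < C ;
  wp_rad : forall j, 0 < rad j <= s0 ;
  wp_test : forall j, test_function U (chi j) ;
  wp_ge0 : forall j x, 0 <= chi j x ;
  wp_act : forall j x, ~~ act j x -> chi j x = 0 /\ forall i, partial i (chi j) x = 0 ;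
  wp_le1 : forall J x, \sum_(j < J) chi j x <= 1 ;
  wp_sum : forall x, U x -> exists J0, forall J, (J0 <= J)%N ->
    \sum_(j < J) chi j x = 1 /\ forall i, \sum_(j < J) partial i (chi j) x = 0 ;
  wp_fin : forall x, exists J0, forall j, (J0 <= j)%N -> ~~ act j x ;
  wp_bound : forall J k i x, act k x -> \sum_(j < J) `|partial i (chi j) x| <= C / rad k ;
  wp_near : forall j x, act j x -> `|x - cen j| <= 2 * rad j ;
  wp_rad_le : forall j k x, act j x -> act k x -> rad j <= 11 * rad k ;
  wp_bnd : forall j x, act j x -> rad j = s0 \/ exists2 y, ~ U y & `|y - cen j| <= 9 * rad j }.

Lemma whitney_partition_exists (U : set 'rV[R]_n) (s0 : R) : open U -> 0 < s0 ->
  exists C chi cen rad act, whitney_partition U s0 C chi cen rad act.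
Proof.
move=> oU s0_gt0.
have [cen [rad [val [N [radP valU cov bnd [actr actN]]]]]] := whitney_covering oU s0_gt0.
have rad0 j : 0 < rad j by case/andP: (radP j).
have [C C0 HC] := partial_chi_bound rad0 actr actN.
exists C, (whitney_chi cen rad val), cen, rad, (fun j x => val j && (`|x - cen j| <= 2 * rad j)).
split=> //.
- by move=> j; exact: (chi_test rad0 valU).
- by move=> j x; exact: chi_ge0.
- by move=> j x; exact: (chi_act rad0).
- by move=> J x; exact: sum_chi_le1.
- by move=> x; exact: (chi_partition rad0 cov).
- by move=> x; exact: (act_finite actN).
- by move=> j x /andP[].
- by move=> j x /andP[/bnd].
Qed.

Lemma test_function_smooth (U : set 'rV[R]_n) (phi : 'rV[R]_n -> R) : test_function U phi -> smooth phi.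
Proof. by case. Qed.

Lemma test_functionW (U : set 'rV[R]_n) (phi : 'rV[R]_n -> R) :
  test_function U phi -> test_function setT phi.
Proof. by case=> sphi cphi _; split. Qed.

Lemma test_functionM (U : set 'rV[R]_n) (phi f : 'rV[R]_n -> R) :
  test_function U phi -> smooth f -> test_function U (fun x => phi x * f x).
Proof.
move=> [sphi cphi pU] sf.
have sub : closure [set x | phi x * f x != 0] `<=` closure [set x | phi x != 0].
  by apply: closure_subset => x /=; apply: contra => /eqP ->; rewrite mul0r.
split; last by move=> x /sub /pU.
- by apply/smoothP => k; apply: CkM; exact: (smoothP _).1.
- by apply: subclosed_compact cphi sub; exact: closed_closure.
Qed.

Lemma derive_subc (f : 'rV[R]_n -> R) (c : R) i x : derivable f x (delta_mx ord0 i) ->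
  derivable (fun y => f y - c) x (delta_mx ord0 i) /\
  partial i (fun y => f y - c) x = partial i f x.
Proof.
move=> df; have dc := @derivable_cst R 'rV[R]_n R c x (delta_mx ord0 i).
split; first exact: derivableB df dc.
by rewrite /partial (deriveB df dc) derive_cst subr0.
Qed.

Lemma smooth_subc (f : 'rV[R]_n -> R) (c : R) : smooth f -> smooth (fun x => f x - c).
Proof. by move=> sf; apply/smoothP => k; apply: CkD; [exact: (smoothP _).1|exact: Ck_cst]. Qed.

End whitney_partition.

(** * The normal trace as a series over Whitney cubes *)

Section trace_formula.
Context {R : realType} {n : nat}.
Variables (U : set 'rV[R]_n) (s0 C : R) (chi : nat -> 'rV[R]_n -> R)
  (cen : nat -> 'rV[R]_n) (rad : nat -> R) (act : nat -> 'rV[R]_n -> bool).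
Hypothesis openU : open U.
Hypothesis wp : whitney_partition U s0 C chi cen rad act.
Variables (p : nat -> 'rV[R]_n) (e : nat -> bool).
Hypothesis p_near : forall j, e j -> `|p j - cen j| <= 10 * rad j.
Hypothesis e_rad : forall j x, act j x -> ~~ e j -> rad j = s0.

Implicit Types (i : 'I_n) (o : option 'I_n) (j k J : nat) (x : 'rV[R]_n) (phi : 'rV[R]_n -> R).
Local Notation D := (U : set (borelRn R n)).
Local Notation bm := (bounded_measurable D).

(** Value at the exterior node of the j-th cube.  The cubes with [e j] false have
    no node; they are of radius s0, for which the value 0 will do. *)
Definition node j phi : R := if e j then phi (p j) else 0.

Let mD : measurable D. Proof. exact: open_measurableRn. Qed.

Let rad_gt0 j : 0 < rad j. Proof. by case/andP: (wp_rad wp j). Qed.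

Let s0_gt0 : 0 < s0. Proof. by case/andP: (wp_rad wp 0) => r0; exact: lt_le_trans. Qed.

Let bm_jet (V : set 'rV[R]_n) o phi : test_function V phi -> bm (jet o phi).
Proof.
move=> /test_functionW/(jet_bounded_measurable o)[mf [B HB]]; split.
  exact: measurable_funS mf.
by exists B => x _; exact: HB.
Qed.

(** Lipschitz continuity of phi if there is a node; otherwise phi is bounded by
    B = (B / s0) * rad j. *)
Lemma node_close phi : test_function setT phi -> exists2 A : R, 0 <= A &
  forall j k x, act j x -> act k x -> `|phi x - node j phi| <= A * rad k.
Proof.
move=> tphi; have [B B0 HB] := jets_bounded tphi; have [L L0 HL] := test_lipschitz tphi.
have Bs0 : 0 <= B / s0 by rewrite divr_ge0// ltW.
exists (11 * (12 * L + B / s0)); first by rewrite mulr_ge0// addr_ge0// mulr_ge0.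
move=> j k x aj ak.
apply: (@le_trans _ _ ((12 * L + B / s0) * rad j)); last first.
  rewrite -mulrA [11 * _]mulrCA ler_wpM2l ?(wp_rad_le wp aj ak)//.
  by rewrite addr_ge0// mulr_ge0.
have rj := rad_gt0 j.
rewrite /node mulrDl; have [ej|ej] := boolP (e j).
  rewrite distrC; apply: le_trans (HL _ _) _.
  rewrite ler_wpDr ?(mulr_ge0 Bs0 (ltW rj))// [12 * L]mulrC -mulrA ler_wpM2l//.
  apply: le_trans (ler_distD (cen j) _ _) _; rewrite (distrC (cen j)).
  by have := p_near ej; have := wp_near wp aj; lra.
rewrite subr0 (e_rad aj ej) divfK ?gt_eqF// ler_wpDl ?mulr_ge0 ?(ltW s0_gt0)//.
exact: (HB None).
Qed.

Let node_bounded phi (B : R) : (forall x, `|phi x| <= B) -> forall j, `|node j phi| <= B.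
Proof.
move=> HB j; rewrite /node; case: ifP => // _; rewrite normr0.
exact: le_trans (normr_ge0 _) (HB 0).
Qed.

(** At each point only finitely many terms are nonzero.  [W None] is the Whitney
    extension of the node values and [W (Some i)] its partials. *)
Lemma whitney_sum phi : exists W : option 'I_n -> 'rV[R]_n -> R,
  forall x, exists J0, forall J, (J0 <= J)%N -> forall o,
    \sum_(j < J) node j phi * jet o (chi j) x = W o x.
Proof.
have [J0 HJ0] := choice (wp_fin wp).
exists (fun o x => \sum_(j < J0 x) node j phi * jet o (chi j) x) => x.
exists (J0 x) => J J0J o.
rewrite -(big_mkord xpredT (fun j => node j phi * jet o (chi j) x)).
rewrite (@big_cat_nat _ _ _ (J0 x))//= big_mkord [X in _ + X]big1_seq ?addr0//.
move=> j /andP[_]; rewrite mem_index_iota => /andP[/HJ0 nact _].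
have [c0 dc0] := wp_act wp nact.
by case: o => [i|] /=; rewrite ?c0 ?dc0 mulr0.
Qed.

Let active_exists x : U x -> exists k, act k x.
Proof.
move=> Ux; apply: contrapT => /forallNP na.
have [J0 /(_ J0 (leqnn _))[+ _]] := wp_sum wp Ux.
rewrite big1 => [/esym/eqP|j _]; first by rewrite oner_eq0.
by have /negP/(wp_act wp)[] := na j.
Qed.

Variable F : DMext U.

Let mu o : smeasure R n := if o is Some i then dm_field F i else dm_div F.

(** The defect of the extension of F by zero: it vanishes on test functions of U,
    and would vanish on all of them if that extension had divergence [dm_div F]. *)
Definition trace phi : R := \sum_o sintegral (mu o) D (jet o phi).

Lemma big_option (f : option 'I_n -> R) : \sum_o f o = f None + \sum_i f (Some i).
Proof.
rewrite (bigD1 None)//=; congr (_ + _).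
rewrite (reindex_omap Some id)//=; last by case.
by apply: eq_bigl => i; rewrite eqxx.
Qed.

Let trace0 phi : test_function U phi -> trace phi = 0.
Proof. by move=> tphi; rewrite /trace big_option/= (dm_divP F tphi) subrr. Qed.

(** [weight k 0] is the integral of chi k against the divergence ([weight0]), here
    written in terms of the field, so that the weights depend on the field alone. *)
Definition weight k s : R := if s is j.+1
  then \sum_i sintegral (dm_field F i) D (fun x => chi k x * partial i (chi j) x)
  else - \sum_i sintegral (dm_field F i) D (partial i (chi k)).

Definition overlap k j := `[< exists x, act k x /\ act j x >].

(** The differences over cubes that do not overlap are replaced by 0, which is
    harmless as their weights vanish; they would not be bounded by [rad k]. *)
Definition base k s phi : R := if s is j.+1
  then (if overlap k j then node j phi - node k phi else 0) else node k phi.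

Let weight0 k : weight k 0 = sintegral (dm_div F) D (chi k).
Proof. by rewrite /weight (dm_divP F (wp_test wp k)) opprK. Qed.

Let no_overlap k j : ~~ overlap k j -> forall i x, chi k x * partial i (chi j) x = 0.
Proof.
move=> /asboolPn no i x; have [ak|nak] := boolP (act k x); last first.
  by have [-> _] := wp_act wp nak; rewrite mul0r.
have [aj|naj] := boolP (act j x); first by case: no; exists x.
by have [_ ->] := wp_act wp naj; rewrite mulr0.
Qed.

Let weight_base k j phi : weight k j.+1 * base k j.+1 phi =
  weight k j.+1 * (node j phi - node k phi).
Proof.
rewrite /base; have [//|no] := boolP (overlap k j).
rewrite /weight big1 ?mul0r// => i _; rewrite -[RHS](sintegral_zero (dm_field F i) mD).
by apply: sintegral_ext => x _; exact: no_overlap.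
Qed.

Section fixed_phi.
Variable phi : 'rV[R]_n -> R.
Hypothesis tphi : test_function setT phi.
Variable W : option 'I_n -> 'rV[R]_n -> R.
Hypothesis WE : forall x, exists J0, forall J, (J0 <= J)%N -> forall o,
    \sum_(j < J) node j phi * jet o (chi j) x = W o x.

Let cvg_eventually (u : nat -> R) (l : R) J0 : (forall J, (J0 <= J)%N -> u J = l) -> u @ \oo --> l.
Proof. by move=> ul; apply: cvg_near_cst; exists J0. Qed.

Let bm_chi o j : bm (jet o (chi j)). Proof. exact: bm_jet (wp_test wp j). Qed.

Let W_cvg o x : (fun J => \sum_(j < J) node j phi * jet o (chi j) x) @ \oo --> W o x.
Proof. by have [J0 HJ0] := WE x; apply: (@cvg_eventually _ _ J0) => J /HJ0. Qed.

Let mW o : measurable_fun D (W o : borelRn R n -> R).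
Proof.
apply: (@measurable_fun_cvg _ (borelRn R n) R D (fun J x => \sum_(j < J) node j phi * jet o (chi j) x)).
  move=> J; apply: measurable_sum => j; apply: measurable_funM => //.
  exact: (bm_chi o j).1.
by move=> x _; exact: W_cvg.
Qed.

Let W_bounded o : exists A : R, forall x, U x -> `|W o x| <= A.
Proof.
have [B B0 HB] := jets_bounded tphi; have [A A0 HA] := node_close tphi.
have vB := node_bounded (HB None).
case: o => [i|]; last first.
  exists B => x Ux; have [J0 HJ0] := WE x; rewrite -(HJ0 J0 (leqnn _)) /=.
  apply: le_trans (ler_norm_sum _ _ _) _.
  apply: (@le_trans _ _ (\sum_(j < J0) B * chi j x)).
    by apply: ler_sum => j _; rewrite normrM (ger0_norm (wp_ge0 wp j x)) ler_wpM2r ?(wp_ge0 wp).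
  by rewrite -mulr_sumr ler_piMr// (wp_le1 wp).
exists (A * C) => x Ux; have [J0 HJ0] := WE x; have [J1 HJ1] := wp_sum wp Ux.
have [_ dc] := HJ1 _ (leq_maxr J0 J1).
rewrite -(HJ0 _ (leq_maxl J0 J1)) /=; set J := maxn _ _ in dc *.
have [k ak] := active_exists Ux; have rk := rad_gt0 k.
(* The partials of the partition sum up to 0, so phi x may be subtracted. *)
have -> : \sum_(j < J) node j phi * partial i (chi j) x =
    \sum_(j < J) (node j phi - phi x) * partial i (chi j) x.
  under [RHS]eq_bigr do rewrite mulrBl.
  by rewrite sumrB -mulr_sumr dc mulr0 subr0.
apply: le_trans (ler_norm_sum _ _ _) _.
apply: (@le_trans _ _ (\sum_(j < J) A * rad k * `|partial i (chi j) x|)).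
  apply: ler_sum => j _; rewrite normrM; have [aj|naj] := boolP (act j x).
    by rewrite ler_wpM2r// distrC HA.
  by have [_ ->] := wp_act wp naj; rewrite normr0 !mulr0.
rewrite -mulr_sumr; apply: le_trans (ler_wpM2l _ (wp_bound wp J i ak)) _.
  by rewrite mulr_ge0// ltW.
by rewrite mulrACA mulfV ?gt_eqF// mulr1.
Qed.

Let bmW o : bm (W o). Proof. by split; [exact: mW|exact: W_bounded]. Qed.

Let theta j : 'rV[R]_n -> R := fun x => chi j x * (phi x - node j phi).

Let theta_test j : test_function U (theta j).
Proof.
apply: test_functionM (wp_test wp j) _.
by apply: smooth_subc; exact: test_function_smooth tphi.
Qed.

Let jet_theta i j x : partial i (theta j) x =
  chi j x * partial i phi x + (phi x - node j phi) * partial i (chi j) x.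
Proof.
have dchi : derivable (chi j) x (delta_mx ord0 i).
  by apply: smooth_derivable; exact: test_function_smooth (wp_test wp j).
have dphi : derivable phi x (delta_mx ord0 i).
  by apply: smooth_derivable; exact: test_function_smooth tphi.
have [dB EB] := derive_subc (node j phi) dphi.
by rewrite {1}/partial (deriveM dchi dB) -EB.
Qed.

(** The trace vanishes on each theta j = chi j (phi - node j), and the partial sums
    of the theta j converge to phi - W with their first partials.  The convergence
    is dominated: [node_close] gives a factor rad k that compensates the
    size C / rad k of the partials of the chi j. *)
Lemma trace_whitney : trace phi = \sum_o sintegral (mu o) D (W o).
Proof.
have [B B0 HB] := jets_bounded tphi; have [A A0 HA] := node_close tphi.
have vB := node_bounded (HB None).
have bmphi o : bm (jet o phi) by exact: bm_jet tphi.
have lim o : (fun J => sintegral (mu o) D (fun x => \sum_(j < J) jet o (theta j) x)) @ \oo -->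
    sintegral (mu o) D (fun x => jet o phi x + (-1) * W o x).
  apply: (@sintegral_cvg _ _ _ _ _ _ (2 * B + B + A * C)) => //.
  - move=> J; apply: measurable_sum => j; exact: (bm_jet o (theta_test j)).1.
  - by apply: (bounded_measurableD (bmphi o) (bounded_measurableM (bounded_measurable_cst _ _) (bmW o))).1.
  - move=> J x Ux; apply: le_trans (ler_norm_sum _ _ _) _.
    have C0 := ltW (wp_C wp).
    case: o => [i|] /=; last first.
      apply: (@le_trans _ _ (\sum_(j < J) 2 * B * chi j x)).
        apply: ler_sum => j _; rewrite /theta normrM (ger0_norm (wp_ge0 wp j x)) mulrC.
        rewrite ler_wpM2r ?(wp_ge0 wp)//; apply: le_trans (ler_normB _ _) _.
        by have := HB None x; have := vB j; rewrite /=; lra.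
      rewrite -mulr_sumr; apply: (@le_trans _ _ (2 * B)).
        by rewrite ler_piMr ?(wp_le1 wp)// mulr_ge0.
      by rewrite -addrA lerDl addr_ge0// mulr_ge0.
    have [k ak] := active_exists Ux; have rk := rad_gt0 k.
    apply: (@le_trans _ _ (\sum_(j < J) (B * chi j x + A * rad k * `|partial i (chi j) x|))).
      apply: ler_sum => j _; rewrite jet_theta; apply: le_trans (ler_normD _ _) _.
      rewrite !normrM (ger0_norm (wp_ge0 wp j x)) [chi j x * _]mulrC; apply: lerD.
        by rewrite ler_wpM2r ?(wp_ge0 wp)//; exact: (HB (Some i)).
      have [aj|naj] := boolP (act j x); first by rewrite ler_wpM2r// HA.
      by have [_ ->] := wp_act wp naj; rewrite normr0 !mulr0.
    rewrite big_split/= -!mulr_sumr; apply: lerD.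
      apply: (@le_trans _ _ B); first by rewrite ler_piMr ?(wp_le1 wp).
      by rewrite lerDr mulr_ge0.
    apply: le_trans (ler_wpM2l _ (wp_bound wp J i ak)) _; first by rewrite mulr_ge0// ltW.
    by rewrite mulrACA mulfV ?gt_eqF// mulr1.
  - move=> x Ux; have [J0 HJ0] := WE x; have [J1 HJ1] := wp_sum wp Ux.
    apply: (@cvg_eventually _ _ (maxn J0 J1)) => J; rewrite geq_max => /andP[JJ0 JJ1].
    have [c1 dc] := HJ1 _ JJ1; rewrite -(HJ0 _ JJ0) mulN1r.
    case: o => [i|] /=.
      under eq_bigr do rewrite jet_theta mulrBl.
      by rewrite big_split/= sumrB -mulr_suml c1 mul1r -mulr_sumr dc mulr0 sub0r.
    rewrite /theta; under eq_bigr do rewrite mulrBr.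
    by rewrite sumrB -mulr_suml c1 mul1r; congr (_ - _); apply: eq_bigr => j _; rewrite mulrC.
have : (fun J => \sum_o sintegral (mu o) D (fun x => \sum_(j < J) jet o (theta j) x)) @ \oo -->
    \sum_o sintegral (mu o) D (fun x => jet o phi x + (-1) * W o x).
  exact: cvg_sumr.
rewrite (_ : (fun J => _) = cst 0); last first.
  apply/funext => J; under eq_bigr => o _.
    rewrite sintegral_sum//; last by move=> j; exact: bm_jet (theta_test j).
    over.
  by rewrite exchange_big/= big1// => j _; exact: trace0 (theta_test j).
move=> /(cvg_unique _ (cvg_cst 0)) - /(_ _) E.
have {}E : 0 = \sum_o sintegral (mu o) D (fun x => jet o phi x + (-1) * W o x) by exact: E.
apply/eqP; rewrite -subr_eq0 /trace -sumrB; apply/eqP; rewrite [RHS]E.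
apply: eq_bigr => o _.
by rewrite sintegral_add// ?sintegral_scale ?mulN1r//; apply: bounded_measurableM => //; exact: bounded_measurable_cst.
Qed.

Let bm_chi_partial k i j : bm (fun x => chi k x * partial i (chi j) x).
Proof. exact: bounded_measurableM (bm_chi None k) (bm_chi (Some i) j). Qed.

(** The sum of the k-th row.  The terms - node k * partial i (chi j) contribute
    nothing, as the partials of the partition sum up to 0. *)
Let inner k : R := sintegral (dm_div F) D (chi k) * node k phi +
  \sum_i sintegral (dm_field F i) D (fun x => chi k x * W (Some i) x).

Let inner_cvg k : (fun S => \sum_(s < S) weight k s * base k s phi) @ \oo --> inner k.
Proof.
have [B B0 HB] := jets_bounded tphi; have vB := node_bounded (HB None).
rewrite -cvg_shiftS.
pose g i J x := chi k x * \sum_(j < J) (node j phi - node k phi) * partial i (chi j) x.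
have bdiff i j : bm (fun x => (node j phi - node k phi) * partial i (chi j) x).
  exact: bounded_measurableM (bounded_measurable_cst _ _) (bm_chi (Some i) j).
have bg i J : bm (g i J).
  apply: bounded_measurableM; first exact: (bm_chi None k).
  by apply: bounded_measurable_sum => j; exact: bdiff.
rewrite (_ : (fun S => _) = (fun J => weight k 0 * node k phi +
    \sum_i sintegral (dm_field F i) D (g i J))); last first.
  apply/funext => J; rewrite big_ord_recl; congr (_ + _).
  transitivity (\sum_(j < J) weight k j.+1 * (node j phi - node k phi)).
    by apply: eq_bigr => j _; exact: weight_base.
  rewrite /weight; under eq_bigr do rewrite mulr_suml.
  rewrite exchange_big/=; apply: eq_bigr => i _.
  rewrite -[RHS](@sintegral_ext _ _ _ _ (fun x => \sum_(j < J)
     (node j phi - node k phi) * (chi k x * partial i (chi j) x))); last first.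
    by move=> x _; rewrite /g mulr_sumr; apply: eq_bigr => j _; rewrite mulrCA.
  rewrite sintegral_sum//; last first.
    by move=> j; apply: bounded_measurableM => //; exact: bounded_measurable_cst.
  by apply: eq_bigr => j _; rewrite sintegral_scale// mulrC.
rewrite weight0 /inner; apply: cvgD; first exact: cvg_cst.
apply: cvg_sumr => i.
apply: (@sintegral_cvg _ _ _ _ _ _ (2 * B * (C / rad k))) => //.
- by move=> J; exact: (bg i J).1.
- exact: (bounded_measurableM (bm_chi None k) (bmW (Some i))).1.
- have Crk : 0 <= C / rad k by rewrite divr_ge0// ltW// (wp_C wp).
  move=> J x Ux; rewrite /g; have [ak|nak] := boolP (act k x); last first.
    by have [-> _] := wp_act wp nak; rewrite mul0r normr0 mulr_ge0// mulr_ge0.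
  rewrite normrM (ger0_norm (wp_ge0 wp k x)).
  have chi1 : chi k x <= 1.
    apply: le_trans (wp_le1 wp k.+1 x); rewrite big_ord_recr/= lerDr sumr_ge0// => j _.
    exact: (wp_ge0 wp).
  apply: (@le_trans _ _ (\sum_(j < J) 2 * B * `|partial i (chi j) x|)).
    apply: le_trans (ler_piMl _ chi1) _ => //.
    apply: le_trans (ler_norm_sum _ _ _) _; apply: ler_sum => j _; rewrite normrM ler_wpM2r//.
    by apply: le_trans (ler_normB _ _) _; have := vB j; have := vB k; lra.
  by rewrite -mulr_sumr ler_wpM2l ?mulr_ge0// (wp_bound wp).
move=> x Ux; have [J0 HJ0] := WE x; have [J1 HJ1] := wp_sum wp Ux.
apply: (@cvg_eventually _ _ (maxn J0 J1)) => J; rewrite geq_max => /andP[JJ0 JJ1].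
have [_ dc] := HJ1 _ JJ1; rewrite /g; congr (_ * _).
under eq_bigr do rewrite mulrBl.
by rewrite sumrB -mulr_sumr dc mulr0 subr0 (HJ0 _ JJ0 (Some i)).
Qed.

Let outer_cvg : (fun K => \sum_(k < K) inner k) @ \oo --> trace phi.
Proof.
have [B B0 HB] := jets_bounded tphi; have vB := node_bounded (HB None).
rewrite trace_whitney big_option/=.
pose h0 K x := \sum_(k < K) node k phi * chi k x.
pose h i K x := (\sum_(k < K) chi k x) * W (Some i) x.
have b0 k : bm (fun x => node k phi * chi k x).
  exact: bounded_measurableM (bounded_measurable_cst _ _) (bm_chi None k).
have bsum K : bm (fun x => \sum_(k < K) chi k x).
  by apply: bounded_measurable_sum => k; exact: (bm_chi None k).
rewrite (_ : (fun K => _) = (fun K => sintegral (dm_div F) D (h0 K) +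
    \sum_i sintegral (dm_field F i) D (h i K))); last first.
  apply/funext => K; rewrite big_split/=; congr (_ + _).
    rewrite sintegral_sum//; apply: eq_bigr => k _.
    have -> := sintegral_scale (dm_div F) (node k phi) mD (bm_chi None k).
    by rewrite [RHS]mulrC.
  rewrite exchange_big/=; apply: eq_bigr => i _.
  rewrite -[RHS](@sintegral_ext _ _ _ _ (fun x => \sum_(k < K) chi k x * W (Some i) x)).
    rewrite sintegral_sum// => k.
    exact: bounded_measurableM (bm_chi None k) (bmW (Some i)).
  by move=> x _; rewrite /h mulr_suml.
apply: cvgD.
  apply: (@sintegral_cvg _ _ _ _ _ _ B) => //.
  - by move=> K; apply: (bounded_measurable_sum _ _).1 => k; exact: b0.
  - move=> K x Ux; apply: le_trans (ler_norm_sum _ _ _) _.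
    apply: (@le_trans _ _ (\sum_(k < K) B * chi k x)).
      by apply: ler_sum => k _; rewrite normrM (ger0_norm (wp_ge0 wp k x)) ler_wpM2r ?(wp_ge0 wp).
    by rewrite -mulr_sumr ler_piMr// (wp_le1 wp).
  - by move=> x Ux; have H := @W_cvg None x; exact: H.
apply: cvg_sumr => i; have [A HA] := W_bounded (Some i).
apply: (@sintegral_cvg _ _ _ _ _ _ A) => //.
- by move=> K; exact: (bounded_measurableM (bsum K) (bmW (Some i))).1.
- move=> K x Ux; rewrite /h normrM; apply: le_trans (HA x Ux).
  rewrite ger0_norm; last by apply: sumr_ge0 => k _; exact: (wp_ge0 wp).
  by rewrite ler_piMl// (wp_le1 wp).
move=> x Ux; have [J1 HJ1] := wp_sum wp Ux.
apply: (@cvg_eventually _ _ J1) => K KJ1; have [c1 _] := HJ1 _ KJ1.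
by rewrite /h c1 mul1r.
Qed.

Lemma trace_series_aux : exists y : nat -> R,
  (forall k, (fun S => \sum_(s < S) weight k s * base k s phi) @ \oo --> y k) /\
  (fun K => \sum_(k < K) y k) @ \oo --> trace phi.
Proof. by exists inner; split; [exact: inner_cvg|exact: outer_cvg]. Qed.

End fixed_phi.

Lemma trace_series phi : test_function setT phi -> exists y : nat -> R,
  (forall k, (fun S => \sum_(s < S) weight k s * base k s phi) @ \oo --> y k) /\
  (fun K => \sum_(k < K) y k) @ \oo --> trace phi.
Proof. by move=> tphi; have [W WE] := whitney_sum phi; exact: trace_series_aux WE. Qed.

(** The length scale rad k cancels the size C / rad k of the partials: for each i the
    integrand K rad k chi_k sum_j |d_i chi_j|, summed over k, is at most
    K C sum_k chi_k <= K C. *)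
Lemma weight_bound (K : R) (Kk S : nat) : 0 <= K ->
  \sum_(k < Kk) \sum_(s < S) `|weight k s| * (if (s : nat) is 0 then 1 else K * rad k) <=
  fine (charge_variation (hahnP (dm_div F)) D) +
  K * C * \sum_i fine (charge_variation (hahnP (dm_field F i)) D).
Proof.
move=> K0; have C0 := ltW (wp_C wp).
have v0 mu' : 0 <= fine (charge_variation (hahnP mu') D) by apply: fine_ge0; exact: measure_ge0.
case: S => [|J].
  rewrite big1 ?addr_ge0 ?mulr_ge0 ?sumr_ge0// => k _; by rewrite big_ord0.
under eq_bigr do rewrite big_ord_recl.
rewrite big_split; apply: lerD.
  under eq_bigr do rewrite mulr1 weight0.
  rewrite -[leRHS]mul1r.
  apply: (sintegral_normr_sum (dm_div F) (f := fun k : 'I_Kk => chi k) mD) => [k|x _].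
    exact: (bm_jet None (wp_test wp k)).1.
  apply: le_trans (wp_le1 wp Kk x); apply: ler_sum => k _.
  by rewrite ger0_norm ?(wp_ge0 wp).
pose f i (kj : 'I_Kk * 'I_J) x := K * rad kj.1 * (chi kj.1 x * partial i (chi kj.2) x).
have bcp i (k j : nat) : bm (fun x => chi k x * partial i (chi j) x).
  exact: bounded_measurableM (bm_jet None (wp_test wp k)) (bm_jet (Some i) (wp_test wp j)).
have Kr k : 0 <= K * rad k by rewrite mulr_ge0// ltW.
apply: (@le_trans _ _ (\sum_i \sum_kj `|sintegral (dm_field F i) D (f i kj)|)).
  rewrite [leRHS]exchange_big [leLHS]pair_bigA; apply: ler_sum => -[k j] _ /=.
  apply: le_trans (ler_wpM2r (Kr k) (ler_norm_sum _ _ _)) _.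
  rewrite mulr_suml; apply: ler_sum => i _.
  by rewrite /f /= sintegral_scale// normrM (ger0_norm (Kr k)) mulrC.
rewrite mulr_sumr; apply: ler_sum => i _.
apply: sintegral_normr_sum => // [kj|x Ux].
  exact: (bounded_measurableM (bounded_measurable_cst _ _) (bcp i kj.1 kj.2)).1.
rewrite -(pair_bigA _ (fun (k : 'I_Kk) (j : 'I_J) => `|f i (k, j) x|))/=.
apply: (@le_trans _ _ (\sum_(k < Kk) K * C * chi k x)); last first.
  by rewrite -mulr_sumr ler_piMr ?mulr_ge0// (wp_le1 wp).
apply: ler_sum => k _; have [ak|nak] := boolP (act k x); last first.
  have [c0 _] := wp_act wp nak; rewrite c0 mulr0 big1// => j _.
  by rewrite /f/= c0 mul0r mulr0 normr0.
apply: (@le_trans _ _ (\sum_(j < J) K * rad k * chi k x * `|partial i (chi j) x|)).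
  apply: ler_sum => j _; rewrite /f/= !normrM (ger0_norm (wp_ge0 wp k x)).
  by rewrite -normrM (ger0_norm (Kr k)) !mulrA.
rewrite -mulr_sumr; apply: le_trans (ler_wpM2l _ (wp_bound wp J i ak)) _.
  by rewrite mulr_ge0 ?(wp_ge0 wp).
rewrite le_eqVlt; apply/orP; left; apply/eqP.
by field; rewrite gt_eqF.
Qed.

(** If both nodes exist, their distance is at most 10 rad k + 2 rad k + 2 rad j +
    10 rad j <= 144 rad k, since rad j <= 11 rad k.  If one is missing, then
    s0 <= 11 rad k and a point mass costs at most (11 / s0) rad k. *)
Lemma base_represented (K delta : R) : 0 <= K -> 144 * s0 < delta ->
  (forall j, e j -> ~ closure U (p j)) ->
  (forall q q' : 'rV[R]_n, ~ closure U q -> ~ closure U q' -> `|q - q'| < delta ->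
    represented D (K * `|q - q'|) (fun phi => phi q' - phi q)) ->
  forall k s, represented D (if s is 0 then 1 else (144 * K + 11 / s0) * rad k) (base k s).
Proof.
move=> K0 sdelta pU H k s.
have nU j : e j -> ~ U (p j) by move=> /pU npj Upj; apply: npj; exact: subset_closure.
have pt j : represented D 1 (node j).
  have [ej|/negbTE ej] := boolP (e j).
    by apply: (eq_represented _ (represented_point mD (nU j ej))) => phi; rewrite /node ej.
  by apply: (eq_represented _ (represented0 D ler01)) => phi; rewrite /node ej.
case: s => [|j]; first exact: pt.
rewrite /base; have K'0 : 0 <= (144 * K + 11 / s0) * rad k.
  by rewrite mulr_ge0 ?(ltW (rad_gt0 k))// addr_ge0 ?(mulr_ge0 _ K0)// divr_ge0// ltW.
case: (asboolP (exists x, act k x /\ act j x)) => [[x [ak aj]]|no]; last first.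
  have nov : overlap k j = false by apply/asboolPn.
  by apply: (eq_represented _ (represented0 D K'0)) => phi; rewrite nov.
have ov : overlap k j by apply/asboolP; exists x.
have rj := rad_gt0 j; have rk := rad_gt0 k.
have rjk := wp_rad_le wp aj ak; have rkj := wp_rad_le wp ak aj.
have [/andP[_ rks] /andP[_ rjs]] := (wp_rad wp k, wp_rad wp j).
(* The case of a missing node: point masses are affordable. *)
have one : e j = false \/ e k = false -> 1 <= (144 * K + 11 / s0) * rad k.
  move=> ejk; apply: (@le_trans _ _ (11 / s0 * rad k)); last first.
    by rewrite [leRHS]mulrDl lerDr !mulr_ge0// ltW.
  rewrite mulrAC ler_pdivlMr// mul1r; case: ejk => [/negbT ej|/negbT ek].
    by rewrite -(e_rad aj ej).
  by rewrite -(e_rad ak ek); lra.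
have ext M L : (forall phi, L phi = node j phi - node k phi) -> represented D M L ->
    represented D M (fun phi => if overlap k j then node j phi - node k phi else 0).
  by move=> LE; apply: eq_represented => phi; rewrite ov.
case ej : (e j); case ek : (e k).
- have pk_j : `|p k - p j| <= 144 * rad k.
    have := ler_distD (cen k) (p k) x; have := ler_distD (cen j) x (p j).
    have := ler_distD x (p k) (p j); have := p_near ej; have := p_near ek.
    have := wp_near wp aj; have := wp_near wp ak.
    rewrite (distrC (cen k) x) (distrC (cen j) (p j)); lra.
  apply: (ext _ (fun phi => phi (p j) - phi (p k))).
    by move=> phi; rewrite /node ej ek.
  apply: representedW (H _ _ (pU _ ek) (pU _ ej) _).
    rewrite [leRHS]mulrDl; apply: (@le_trans _ _ (K * (144 * rad k))); first by rewrite ler_wpM2l.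
    by rewrite mulrCA mulrA lerDl mulr_ge0 ?(ltW rk)// divr_ge0// ltW.
  by apply: le_lt_trans pk_j _; apply: le_lt_trans sdelta; rewrite ler_pM2l.
- apply: (ext _ (node j)); first by move=> phi; rewrite /node ek subr0.
  by apply: representedW (pt j); apply: one; right.
- apply: (ext _ (fun phi => 0 + (-1) ^+ true * node k phi)).
    by move=> phi; rewrite [node j _]/node ej /= expr1 mulN1r.
  apply: representedW (representedB true mD (represented0 D (lexx 0)) (pt k)).
  by rewrite add0r; apply: one; left.
- apply: (ext _ (fun=> 0)); first by move=> phi; rewrite /node ej ek subrr.
  exact: represented0.
Qed.

End trace_formula.

(** * Superposition of represented functionals *)

Section superposition.
Context {R : realType} {n : nat}.
Local Notation family := (option 'I_n ->
  {finite_measure set (borelRn R n) -> \bar R} * {finite_measure set (borelRn R n) -> \bar R}).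
Implicit Types (U : set (borelRn R n)) (w m : nat -> nat -> R).

Definition total_mass w m (M : R) :=
  forall K S, \sum_(k < K) \sum_(s < S) `|w k s| * m k s <= M.

Lemma sum_ord_ndecr (f : nat -> R) : (forall s, 0 <= f s) ->
  {homo (fun S => \sum_(s < S) f s) : a b / (a <= b)%N >-> a <= b}.
Proof.
move=> f0; apply: homo_leq => [//|x y z|S]; first exact: le_trans.
by rewrite big_ord_recr/= lerDl.
Qed.

(** Two successive mixtures, over [s] and then over [k]; the mass of the k-th row is
    the limit of its nondecreasing partial sums. *)
Lemma double_series_family (nu : nat -> nat -> family) U w m (M : R) : measurable U ->
  (forall k s, carried (nu k s) U (m k s)) -> total_mass w m M ->
  exists nu', carried nu' U M /\ forall phi, test_function setT phi ->
    forall y : nat -> R,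
    (forall k, (fun S => \sum_(s < S) w k s * pairing (nu k s) phi) @ \oo --> y k) ->
    (fun K => \sum_(k < K) y k) @ \oo --> pairing nu' phi.
Proof.
move=> mU cnu wM.
have f0 k s : 0 <= `|w k s| * m k s by rewrite mulr_ge0// (carried_ge0 (cnu k s)).
pose a k S := \sum_(s < S) `|w k s| * m k s.
have aM k S : a k S <= M.
  apply: le_trans (wM k.+1 S); rewrite big_ord_recr/= lerDr.
  by apply: sumr_ge0 => k' _; exact: sumr_ge0.
have anm k : {homo a k : x y / (x <= y)%N >-> x <= y} by exact: sum_ord_ndecr (f0 k).
have acvg k : cvgn (a k).
  apply: nondecreasing_is_cvgn; first exact: anm.
  by exists M => _ [S _ <-]; exact: aM.
(* Mass of the k-th row. *)
pose Mk k := limn (a k).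
have aMk k S : a k S <= Mk k.
  by apply: nondecreasing_cvgn_le; [exact: anm|exact: acvg].
have [mu Hmu] := choice (fun k => series_family mU (cnu k) (aMk k)).
have MkM K : \sum_(k < K) Mk k <= M.
  have cv : (fun S => \sum_(k < K) a k S) @ \oo --> \sum_(k < K) Mk k.
    exact: (@cvg_sumr R _ _ (fun k : 'I_K => a k)).
  by apply: (cvgr_to_le cv); apply: nearW => S; exact: wM.
have [K|nu' [cnu' rnu']] := @series_family _ _ mu U (fun=> 1) Mk M mU (fun k => (Hmu k).1).
  by under eq_bigr do rewrite normr1 mul1r.
exists nu'; split=> // phi tphi y wy.
have yE k : y k = pairing (mu k) phi.
  by have := cvg_unique _ (wy k) ((Hmu k).2 phi tphi); exact.
have := rnu' phi tphi; under eq_fun do under eq_bigr do rewrite mul1r -yE.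
exact.
Qed.

(** The family depends on the weights alone, so that fields with the same weights
    receive the same measures.  Its mass is the supremum of the partial sums,
    hence at most every admissible M. *)
Lemma superposition (nu : nat -> nat -> family) U m : measurable U ->
  (forall k s, carried (nu k s) U (m k s)) ->
  exists Nu : (nat -> nat -> R) -> family, forall w M, total_mass w m M ->
    carried (Nu w) U M /\ forall phi, test_function setT phi ->
    forall y : nat -> R,
    (forall k, (fun S => \sum_(s < S) w k s * pairing (nu k s) phi) @ \oo --> y k) ->
    (fun K => \sum_(k < K) y k) @ \oo --> pairing (Nu w) phi.
Proof.
move=> mU cnu.
suff H w : exists nu' : family, forall M, total_mass w m M ->
    carried nu' U M /\ forall phi, test_function setT phi ->
    forall y : nat -> R,
    (forall k, (fun S => \sum_(s < S) w k s * pairing (nu k s) phi) @ \oo --> y k) ->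
    (fun K => \sum_(k < K) y k) @ \oo --> pairing nu' phi.
  by have [Nu HNu] := choice H; exists Nu => w M; exact: HNu.
have [[M wM]|no] := pselect (exists M, total_mass w m M); last first.
  by exists (zero_family) => M wM; case: no; exists M.
pose sums := [set r | exists K S, r = \sum_(k < K) \sum_(s < S) `|w k s| * m k s].
have sums0 : sums !=set0 by exists (\sum_(k < 0) \sum_(s < 0) `|w k s| * m k s); exists 0%N, 0%N.
have wsup : total_mass w m (sup sums).
  move=> K S; apply: sup_upper_bound; last by exists K, S.
  by split=> //; exists M => _ [K' [S' ->]]; exact: wM.
have [nu' [cnu' rnu']] := double_series_family mU cnu wsup.
exists nu' => M' wM'; split=> // o; have [h ? ?] := cnu' o; split=> //.
apply: le_trans h _; apply: ge_sup => // _ [K [S ->]]; exact: wM'.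
Qed.

End superposition.

(** * The extension operator *)

Section extension.
Context {R : realType} {n : nat}.
Variables (U : set 'rV[R]_n).
Hypothesis openU : open U.
Local Notation D := (U : set (borelRn R n)).
Local Notation family := (option 'I_n ->
  {finite_measure set (borelRn R n) -> \bar R} * {finite_measure set (borelRn R n) -> \bar R}).

Let mD : measurable D. Proof. exact: open_measurableRn. Qed.

(** The Hahn sets chosen for the two fields may differ, but the integral is
    determined by the values on Borel sets. *)
Lemma same_on_sintegral (F G : DMext U) i f :
  same_on D (dm_field F) (dm_field G) -> bounded_measurable D f ->
  sintegral (dm_field F i) D f = sintegral (dm_field G i) D f.
Proof.
move=> FG bf; rewrite (@sintegral_diff _ _ _ _ _ (jordan_pos (hahnP (dm_field G i)))
  (jordan_neg (hahnP (dm_field G i))))// => A mA.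
rewrite (dm_field_on F i mA) FG//; last exact: measurableI.
rewrite -(dm_field_on G i mA) (jordan_decomp (hahnP (dm_field G i)) mA).
by rewrite /cadd/= cscaleN1.
Qed.

(** A point off U in the interior of the closure of U would belong to the boundary of
    U but not to that of the exterior. *)
Lemma complement_closure : boundary U = boundary (~` closure U) ->
  ~` U `<=` closure (~` closure U).
Proof.
move=> bdU x nUx; have [cUx|ncUx] := pselect (closure U x); last exact: subset_closure.
have : boundary U x by split=> // /interior_subset.
by rewrite bdU => -[].
Qed.

(** The divergence and the n components of the field each have variation at most the
    norm. *)
Lemma finite_variation_mass (F : DMext U) :
  ((fine (charge_variation (hahnP (dm_div F)) D) +
    \sum_i fine (charge_variation (hahnP (dm_field F i)) D))%:E
   <= n.+1%:R%:E * DMext_norm F)%E.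
Proof.
have v0 (mu : smeasure R n) : (0 <= charge_variation (hahnP mu) D)%E by exact: measure_ge0.
have vf (mu : smeasure R n) : charge_variation (hahnP mu) D \is a fin_num.
  exact: (fin_num_measure (charge_variation (hahnP mu))).
have hdiv : (charge_variation (hahnP (dm_div F)) D <= DMext_norm F)%E.
  rewrite /DMext_norm leeDr//; exact: vvariation_ge0.
have hi i : (charge_variation (hahnP (dm_field F i)) D <= DMext_norm F)%E.
  apply: le_trans (mvar_le_vvariation (dm_field F) i mD) _.
  by rewrite /DMext_norm leeDl.
case N : (DMext_norm F) hdiv hi => [r||] hdiv hi.
- rewrite -EFinM lee_fin -natr1 [leRHS]mulrDl mul1r [leLHS]addrC; apply: lerD; last first.
    by rewrite -lee_fin fineK.
  apply: (@le_trans _ _ (\sum_(i < n) r)); last by rewrite sumr_const card_ord mulr_natl.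
  by apply: ler_sum => i _; rewrite -lee_fin fineK.
- by rewrite gt0_muley ?lte_fin ?ltr0n// leey.
- by have := le_trans (v0 _) hdiv.
Qed.

(** Subtracting [nu] removes the trace: the integrals of the jets of phi against the
    new measures add up to trace F phi - pairing nu phi. *)
Lemma extend (F : DMext U) (nu : family) (M : R) : carried nu D M ->
  (forall phi, test_function setT phi -> trace F phi = pairing nu phi) ->
  exists H : DMext (setT : set 'rV[R]_n),
    (forall i A, dm_field H i A =
       (dm_field F i A - ((nu (Some i)).1 A - (nu (Some i)).2 A))%E) /\
    (DMext_norm H <= (fine (charge_variation (hahnP (dm_div F)) D) +
      \sum_i fine (charge_variation (hahnP (dm_field F i)) D) + n.+1%:R * M)%:E)%E.
Proof.
move=> cnu trE.
pose mu (o : option 'I_n) : smeasure R n := if o is Some i then dm_field F i else dm_div F.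
have muU o : concentrated_on D (mu o).
  by case: o => [i|]; [exact: dm_field_on|exact: dm_div_on].
have [N NE] := choice (fun o => smeasure_sub (mu o) (nu o).1 (nu o).2).
have NT o : concentrated_on setT (N o) by move=> A _; rewrite setIT.
have Ndiv : is_divergence setT (fun i => N (Some i)) (N None).
  move=> phi tphi; apply/eqP; rewrite -addr_eq0; apply/eqP.
  rewrite addrC -(big_option (fun o => sintegral (N o) setT (jet o phi))).
  transitivity (trace F phi - pairing nu phi); last by rewrite trE// subrr.
  rewrite /trace /pairing -sumrB; apply: eq_bigr => o _.
  have bj := jet_bounded_measurable o tphi.
  rewrite (sintegral_sub (fun A _ => NE o A) bj); congr (_ - _).
  exact: (sintegral_concentrated mD (muU o) bj).
exists (Build_DMext (fun i => NT (Some i)) (NT None) Ndiv); split=> [i A|].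
  exact: NE (Some i) A.
have H o : exists pq : {finite_measure set (borelRn R n) -> \bar R} *
    {finite_measure set (borelRn R n) -> \bar R},
    (forall A, measurable A -> N o A = pq.1 A - pq.2 A)%E /\
    (pq.1 setT + pq.2 setT <= (fine (charge_variation (hahnP (mu o)) D) + M)%:E)%E.
  have [p [q [pq pE qE]]] := smeasure_sub_diff (fun A _ => NE o A).
  exists (p, q); split=> //=.
  have [+ _ _] := cnu o.
  have fa := fin_num_measure (nu o).1 _ (@measurableT _ (borelRn R n)).
  have fb := fin_num_measure (nu o).2 _ (@measurableT _ (borelRn R n)).
  rewrite -lee_fin fineK ?fin_numD ?fa ?fb// => hM.
  rewrite EFinD fineK; last exact: (fin_num_measure (charge_variation (hahnP (mu o)))).
  rewrite -(mvar_setT mD (muU o)) (pE _ measurableT) (qE _ measurableT).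
  rewrite addeACA [((nu o).2 _ + _)%E]addeC.
  by apply: leeD.
have [pq Hpq] := choice H.
rewrite /DMext_norm/=.
apply: (@le_trans _ _ (\sum_o ((pq o).1 setT + (pq o).2 setT))%E).
  rewrite (bigD1 None)//= addeC; apply: leeD.
    by apply: mvar_le_diff => A mA; exact: (Hpq None).1.
  rewrite (reindex_omap Some id)/=; last by case.
  under eq_bigl do rewrite eqxx.
  exact: (vvariation_le_diff (fun i A mA => (Hpq (Some i)).1 A mA)).
apply: (@le_trans _ _ (\sum_o (fine (charge_variation (hahnP (mu o)) D) + M)%:E)%E).
  by apply: lee_sum => o _; exact: (Hpq o).2.
rewrite sumEFin lee_fin big_split/= sumr_const card_option card_ord.
by rewrite (big_option (fun o => fine (charge_variation (hahnP (mu o)) D)))/= mulr_natl.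
Qed.

End extension.

Section exterior_nodes.
Context {R : realType} {n : nat}.

(** A cube of radius less than s0 sees a point off U within 9 radii, hence, by
    [complement_closure], a point of the exterior within 10 radii. *)
Lemma exterior_nodes (U : set 'rV[R]_n) (s0 C : R) chi cen rad act :
  boundary U = boundary (~` closure U) ->
  whitney_partition U s0 C chi cen rad act ->
  exists (p : nat -> 'rV[R]_n) (e : nat -> bool),
    [/\ forall j, e j -> ~ closure U (p j),
        forall j, e j -> `|p j - cen j| <= 10 * rad j &
        forall j x, act j x -> ~~ e j -> rad j = s0].
Proof.
move=> bdU wp.
pose near j (y : 'rV[R]_n) := ~ closure U y /\ `|y - cen j| <= 10 * rad j.
have /choice[p Hp] j : exists q, (exists y, near j y) -> near j q.
  by have [[y yj]|no] := pselect (exists y, near j y); [exists y|exists 0].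
exists p, (fun j => `[< exists y, near j y >]); split=> [j /asboolP/Hp[]//|j /asboolP/Hp[]//|].
move=> j x /(wp_bnd wp)[//|[y nUy yj]] /asboolPn[].
have /andP[rj _] := wp_rad wp j.
have [z [nUz]] := complement_closure bdU nUy (nbhsx_ballx y _ rj).
rewrite -ball_normE/= => yz; exists z; split=> //.
apply: le_trans (ler_distD y _ _) _; rewrite distrC.
by have := ltW yz; lra.
Qed.

End exterior_nodes.

Theorem theorem1p5 (R : realType) (n : nat) (hn : (2 <= n)%N)
    (U : set 'rV[R]_n) (openU : open U)
    (qcU : locally_uniformly_quasiconvex (~` closure U))
    (bdU : boundary U = boundary (~` closure U)) :
  exists E : DMext U -> DMext (setT : set 'rV[R]_n),
    [/\ forall F G : DMext U, same_on U F G -> same_on setT (E F) (E G),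
        forall F : DMext U, same_on U (E F) F &
        exists C : R, forall F : DMext U,
          (DMext_norm (E F) <= C%:E * DMext_norm F)%E].
Proof.
have [K [delta [K0 delta0 qc]]] := quasiconvex_represented openU qcU.
(* Any s0 with 144 s0 < delta keeps the nodes of overlapping cubes within delta. *)
have s0_gt0 : 0 < delta / 145 by rewrite divr_gt0.
have [C [chi [cen [rad [act wp]]]]] := whitney_partition_exists openU s0_gt0.
have [p [e [pU p_near e_rad]]] := exterior_nodes bdU wp.
set s0 := delta / 145 in s0_gt0 wp e_rad.
have s0_delta : 144 * s0 < delta by rewrite /s0; lra.
pose K' := 144 * K + 11 / s0.
have K'0 : 0 <= K' by apply: addr_ge0; [apply: mulr_ge0 (ltW K0)|apply: divr_ge0 (ltW s0_gt0)].
have baseR := base_represented openU wp p_near e_rad (ltW K0) s0_delta pU qc.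
have /choice[nu Hnu] k : exists f, forall s,
    carried (f s) U (if s is 0 then 1 else K' * rad k) /\
    forall phi, test_function setT phi -> base act p e k s phi = pairing (f s) phi.
  by have [f Hf] := choice (baseR k); exists f.
have mU := open_measurableRn openU.
have [Nu HNu] := superposition mU (fun k s => (Hnu k s).1).
pose mass (F : DMext U) := fine (charge_variation (hahnP (dm_div F)) (U : set (borelRn R n))) +
  \sum_i fine (charge_variation (hahnP (dm_field F i)) (U : set (borelRn R n))).
have C0 := ltW (wp_C wp).
have v0 (m : smeasure R n) : 0 <= fine (charge_variation (hahnP m) (U : set (borelRn R n))).
  by apply: fine_ge0; exact: measure_ge0.
have KC0 : 0 <= K' * C by rewrite mulr_ge0.
have Fmass (F : DMext U) : total_mass (weight chi F)
    (fun k s => if s is 0 then 1 else K' * rad k) ((1 + K' * C) * mass F).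
  move=> k s; apply: le_trans (weight_bound openU wp F k s K'0) _.
  rewrite /mass mulrDr; apply: lerD.
    by rewrite ler_peMl// lerDl.
  by apply: ler_wpM2r; [exact: sumr_ge0|rewrite lerDr].
have trE (F : DMext U) phi : test_function setT phi ->
    trace F phi = pairing (Nu (weight chi F)) phi.
  move=> tphi; have [y [wy ty]] := trace_series openU wp p_near e_rad F tphi.
  have [_ HF] := HNu _ _ (Fmass F).
  have ty' : (fun K => \sum_(k < K) y k) @ \oo --> pairing (Nu (weight chi F)) phi.
    apply: (HF phi tphi y _) => k; rewrite [X in X @ _](_ : _ =
      fun S => \sum_(s < S) weight chi F k s * base act p e k s phi); first exact: wy.
    by apply/funext => S; apply: eq_bigr => s _; rewrite ((Hnu k s).2 phi tphi).
  by have := cvg_unique _ ty ty'; exact.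
have [E HE] := choice (fun F => extend openU (HNu _ _ (Fmass F)).1 (trE F)).
exists E; split.
- move=> F G FG A mA _ i; rewrite (HE F).1 (HE G).1.
  have -> : weight chi F = weight chi G.
    apply/funext => k; apply/funext => s.
    have bj o j : bounded_measurable (U : set (borelRn R n)) (jet o (chi j)).
      have [mf [B HB]] := jet_bounded_measurable o (test_functionW (wp_test wp j)).
      by split; [exact: measurable_funS mf|exists B => x _; exact: HB].
    case: s => [|j] /=; [congr (- _)|]; apply: eq_bigr => i' _;
      apply: same_on_sintegral => //; first exact: (bj (Some i')).
    exact: bounded_measurableM (bj None k) (bj (Some i') j).
  congr (_ - _)%E; rewrite (dm_field_on F i mA) (dm_field_on G i mA); apply: FG => //.
  exact: measurableI.
- move=> F A mA AU i; rewrite (HE F).1.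
  have [_ a0 b0] := (HNu _ _ (Fmass F)).1 (Some i).
  have null (m : {finite_measure set (borelRn R n) -> \bar R}) : m U = 0%E -> m A = 0%E.
    move=> m0; apply/eqP; rewrite eq_le measure_ge0 andbT -m0.
    by apply: le_measure; rewrite ?inE.
  by rewrite (null _ a0) (null _ b0) !sube0.
exists ((1 + n.+1%:R * (1 + K' * C)) * n.+1%:R) => F.
apply: le_trans (HE F).2 _.
rewrite -/(mass F) [X in (X%:E <= _)%E](_ : _ = (1 + n.+1%:R * (1 + K' * C)) * mass F).
  rewrite EFinM EFinM -muleA; apply: lee_wpmul2l; last exact: finite_variation_mass.
  by rewrite lee_fin addr_ge0// mulr_ge0// addr_ge0.
by rewrite [RHS]mulrDl mul1r -mulrA.
Qed.
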